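(* Let $\pi\colon H\twoheadrightarrow G$ be a fundamental epimorphism of profinite groups. Then $H$ is isomorphic over $G$ to the fiber product over $G$ of the family $(H_\lambda\twoheadrightarrow G)_{\lambda\in\Lambda(G)}$; that is, over $G$, $H$ is isomorphic to the fiber product of $\prod_{G,\ \zeta\in\Lambda_{\mathrm{na}}(G)}H_\zeta$ and $\prod_{G,\ A\in\Lambda_{\mathrm{ab}}(G)}H_A$. Moreover: (a) For every $\zeta\in\Lambda_{\mathrm{na}}(G)$, $H_\zeta$ is isomorphic over $G$ to the fiber product over $G$ of a family $(\eta_i\colon H_i\twoheadrightarrow G)_{i\in I_\zeta}$, where $|I_\zeta|=|\mathcal{C}_\zeta|$ and $\eta_i\cong_G\zeta$ for every $i\in I_\zeta$. (b) For every $A\in\Lambda_{\mathrm{ab}}(G)$ let $\{\phi_i\}_{i\in I_A}$ be a basis of $B_A^*$ over $F_A=\operatorname{End}_G(A)$. Then $H_A$ is isomorphic over $G$ to the fiber product over $G$ of the family $(\eta_i\colon H_i\twoheadrightarrow G)_{i\in I_A}$, where $\eta_i$ is the extension of $G$ by $A$ with class $(\phi_i)_*f_A=S_A(\phi_i)\in H^2(G,A)$, for every $i\in I_A$. Thus $H$ is (isomorphic over $G$ to) the fiber product over $G$ of the family $(\eta_i\colon H_i\twoheadrightarrow G)_{i\in I}$ of indecomposable epimorphisms, where $I$ is the disjoint union of all $I_\zeta$, $\zeta\in\Lambda_{\mathrm{na}}(G)$, and all $I_A$, $A\in\Lambda_{\mathrm{ab}}(G)$.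
   Context: All groups are profinite, homomorphisms are continuous, subgroups are closed; $\twoheadrightarrow$ denotes an epimorphism. Epimorphisms $\eta\colon H\twoheadrightarrow G$, $\pi\colon E\twoheadrightarrow G$ are isomorphic, $\eta\cong_G\pi$ (or $H\cong_G E$, ''isomorphic over $G$''), if there is an isomorphism $\psi\colon H\to E$ with $\eta=\pi\circ\psi$. An epimorphism is indecomposable if it is not an isomorphism and cannot be written as a composition of two epimorphisms neither of which is an isomorphism; equivalently, its kernel is a minimal normal subgroup of its domain. For $M\triangleleft H$, $\mathcal{N}_M(H)$ is the set of maximal elements among the normal subgroups of $H$ strictly contained in $M$. The fundament kernel of $\pi\colon H\twoheadrightarrow G$ is $\mathcal{M}(\pi)=\bigcap_{N\in\mathcal{N}_{\operatorname{Ker}\pi}(H)}N$ (equal to $\operatorname{Ker}\pi$ if $\operatorname{Ker}\pi=1$, when the family is empty). $\pi$ is fundamental if $\mathcal{M}(\pi)=1$. Fiber product: for a family $(\eta_i\colon H_i\twoheadrightarrow G)_{i\in I}$, $\prod_{G,\ i\in I}H_i=\{(h_i)\in\prod_{i\in I}H_i : \eta_i(h_i)=\eta_j(h_j)\ \forall i,j\in I\}$, with structure map to $G$ given by $\eta_i$ of any coordinate; for $I=\emptyset$ it is $G$ with structure map $\mathrm{id}_G$. $\Lambda_{\mathrm{ab}}(G)$ is the set of isomorphism classes of finite simple $G$-modules; $\Lambda_{\mathrm{na}}(G)$ is a set of representatives of the isomorphism classes of indecomposable epimorphisms onto $G$ with non-abelian kernel; $\Lambda(G)=\Lambda_{\mathrm{ab}}(G)\sqcup\Lambda_{\mathrm{na}}(G)$.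 An abelian kernel of an epimorphism onto $G$ is viewed as a $G$-module via conjugation. For $\zeta\in\Lambda_{\mathrm{na}}(G)$: $\mathcal{C}_\zeta=\{N\triangleleft H : N\le\operatorname{Ker}\pi,\ (H/N\twoheadrightarrow G)\cong_G\zeta\}$, $N_\zeta=\bigcap_{N\in\mathcal{C}_\zeta}N$, $H_\zeta=H/N_\zeta$. For $A\in\Lambda_{\mathrm{ab}}(G)$: $\mathcal{C}_A=\{N\triangleleft H : N\le\operatorname{Ker}\pi,\ \operatorname{Ker}\pi/N\cong_G A\}$ (in particular $\operatorname{Ker}\pi/N$ is abelian), $N_A=\bigcap_{N\in\mathcal{C}_A}N$, $H_A=H/N_A$. Intersections over empty families are taken to be $\operatorname{Ker}\pi$. The maps $H_\lambda\twoheadrightarrow G$ are induced by $\pi$. Put $B_A=\operatorname{Ker}(H_A\twoheadrightarrow G)$, a profinite $G$-module; $B_A^*=\operatorname{Hom}_G(B_A,A)$ (continuous $G$-homomorphisms) is a vector space over the finite field $F_A=\operatorname{End}_G(A)$; $f_A\in H^2(G,B_A)$ is the class of the extension $1\to B_A\to H_A\to G\to1$; and $S_A\colon B_A^*\to H^2(G,A)$ is the $F_A$-linear map $\phi\mapsto\phi_*(f_A)$ (continuous cohomology). *)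

(* Defs.v *)
From HB Require Import structures.
From mathcomp Require Import all_boot all_algebra generic_quotient ring_quotient.
From mathcomp Require Import all_classical topology tvs.

Set Implicit Arguments.
Unset Strict Implicit.
Unset Printing Implicit Defensive.

Import GRing.Theory.

Local Open Scope classical_set_scope.
Local Open Scope group_scope.

HB.mixin Record isTopologicalGroup G of Group G & Topological G := {
  mulg_continuous : continuous (fun x : G * G => x.1 * x.2);
  invg_continuous : continuous (fun x : G => x^-1)
}.

#[short(type="topGroupType")]
HB.structure Definition TopologicalGroup :=
  {G of Group G & Topological G & isTopologicalGroup G}.

HB.mixin Record isProfinite G of TopologicalGroup G := {
  profinite_compact : compact [set: G];
  profinite_hausdorff : hausdorff_space G;
  profinite_totally_disconnected : totally_disconnected [set: G]
}.

#[short(type="profiniteGroupType")]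
HB.structure Definition Profinite := {G of TopologicalGroup G & isProfinite G}.

Lemma continuous_mulg (T : topologicalType) (G : topGroupType) (f g : T -> G) :
  continuous f -> continuous g -> continuous (fun x => f x * g x).
Proof.
move=> cf cg x.
apply: (@continuous_comp _ _ _ (fun x => (f x, g x)) (fun p : G * G => p.1 * p.2)).
  by apply: cvg_pair; [exact: cf|exact: cg].
exact: mulg_continuous.
Qed.

Lemma continuous_invg (T : topologicalType) (G : topGroupType) (f : T -> G) :
  continuous f -> continuous (fun x => (f x)^-1).
Proof.
move=> cf x; apply: (@continuous_comp _ _ _ f (fun y : G => y^-1)); first exact: cf.
exact: invg_continuous.
Qed.

Record epi (H G : topGroupType) := Epi {
  epi_fun :> UMagmaMorphism.type H G;
  epi_continuous : continuous epi_fun;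
  epi_surj : forall y, exists x, epi_fun x = y
}.

Definition iso_over (G H E : topGroupType) (eta : epi H G) (pi : epi E G) : Prop :=
  exists (psi : {multiplicative H -> E}) (psi' : E -> H),
    [/\ continuous psi, continuous psi', cancel psi psi', cancel psi' psi
      & forall x, eta x = pi (psi x)].

Definition is_iso (H G : topGroupType) (p : epi H G) : Prop :=
  exists p' : G -> H, [/\ continuous p', cancel p p' & cancel p' p].

Definition indecomposable (H G : profiniteGroupType) (p : epi H G) : Prop :=
  ~ is_iso p /\
  forall (K : profiniteGroupType) (a : epi H K) (b : epi K G),
    (forall x, p x = b (a x)) -> is_iso a \/ is_iso b.

Definition ker (H G : topGroupType) (p : epi H G) : set H := [set x | p x = 1].

Definition abelian_ker (H G : topGroupType) (p : epi H G) : Prop :=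
  forall x y, ker p x -> ker p y -> commute x y.

Record normalSubgroup (H : topGroupType) := NormalSubgroup {
  nsub :> set H;
  nsub1 : nsub 1;
  nsubM : forall x y, nsub x -> nsub y -> nsub (x * y);
  nsubV : forall x, nsub x -> nsub x^-1;
  nsubJ : forall x y, nsub x -> nsub (x ^ y);
  nsub_closed : closed nsub
}.

Definition maximal_normal (H : topGroupType) (M : set H) : set (normalSubgroup H) :=
  [set N | (N : set H) `<` M /\
    forall N' : normalSubgroup H,
      (N' : set H) `<` M -> (N : set H) `<=` N' -> (N : set H) = N'].

(* Intersecting with the kernel gives the stated value when the family is
   empty, and changes nothing otherwise. *)
Definition fundament_kernel (H G : topGroupType) (p : epi H G) : set H :=
  ker p `&` \bigcap_(N in maximal_normal (ker p)) (N : set H).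

Definition fundamental (H G : topGroupType) (p : epi H G) : Prop :=
  fundament_kernel p = [set 1].

Section Quotient.
Variables (H : topGroupType) (N : normalSubgroup H).

Definition coset_equiv : rel H := fun x y => `[< nsub N (x^-1 * y) >].

Lemma coset_equiv_class : equiv_class_of coset_equiv.
Proof.
split=> [x|x y|y x z].
- by apply/asboolP; rewrite mulVg; exact: nsub1.
- by apply: asbool_equiv_eq; split => /nsubV; rewrite invgM invgK.
- move=> /asboolP xy /asboolP yz; apply/asboolP.
  by have := nsubM xy yz; rewrite mulgA mulgK.
Qed.

Canonical coset_equiv_rel := EquivRelPack coset_equiv_class.
Canonical coset_encModRel := defaultEncModRel coset_equiv.

Definition quotg := quotient_topology {eq_quot coset_equiv}%qT.
HB.instance Definition _ := Topological.on quotg.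
HB.instance Definition _ := Quotient.on quotg.

Definition qproj (x : H) : quotg := \pi_quotg%qT x.

Lemma qprojP x y : qproj x = qproj y <-> nsub N (x^-1 * y).
Proof.
split=> [xy|Nxy]; last by apply/eqmodP/asboolP.
by apply/asboolP; have /eqmodP := xy.
Qed.

Lemma qprojK (x : quotg) : qproj (repr x) = x.
Proof. exact: reprK. Qed.

Lemma repr_qproj x : nsub N (x^-1 * repr (qproj x)).
Proof. by apply/qprojP; rewrite qprojK. Qed.

Definition mulq (x y : quotg) : quotg := qproj (repr x * repr y).
Definition invq (x : quotg) : quotg := qproj (repr x)^-1.

Lemma qproj_mulq x y : qproj (x * y) = mulq (qproj x) (qproj y).
Proof.
apply/qprojP; set x' := repr _; set y' := repr _.
have -> : (x * y)^-1 * (x' * y') = (x^-1 * x') ^ y * (y^-1 * y').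
  by rewrite conjgE invgM !mulgA mulgK.
by apply: nsubM; [apply: nsubJ|]; exact: repr_qproj.
Qed.

Lemma qproj_invq x : qproj x^-1 = invq (qproj x).
Proof.
apply/qprojP; set x' := repr _.
have -> : x^-1^-1 * x'^-1 = ((x^-1 * x')^-1) ^ x^-1.
  by rewrite conjgE !invgM !invgK !mulgA mulgK.
by apply/nsubJ/nsubV; exact: repr_qproj.
Qed.

Lemma mulqA : associative mulq.
Proof.
move=> x y z; rewrite -[x]qprojK -[y]qprojK -[z]qprojK.
by rewrite -!qproj_mulq mulgA.
Qed.

Lemma mul1q : left_id (qproj 1) mulq.
Proof. by move=> x; rewrite -[x]qprojK -qproj_mulq mul1g. Qed.

Lemma mulq1 : right_id (qproj 1) mulq.
Proof. by move=> x; rewrite -[x]qprojK -qproj_mulq mulg1. Qed.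

Lemma mulVq : left_inverse (qproj 1) invq mulq.
Proof. by move=> x; rewrite -[x]qprojK -qproj_invq -qproj_mulq mulVg. Qed.

Lemma mulqV : right_inverse (qproj 1) invq mulq.
Proof. by move=> x; rewrite -[x]qprojK -qproj_invq -qproj_mulq mulgV. Qed.

HB.instance Definition _ :=
  isGroup.Build quotg mulqA mul1q mulq1 mulVq mulqV.

Lemma qprojM x y : qproj (x * y) = qproj x * qproj y.
Proof. exact: qproj_mulq. Qed.

Lemma qprojV x : qproj x^-1 = (qproj x)^-1.
Proof. exact: qproj_invq. Qed.

Lemma qproj_continuous : continuous qproj.
Proof. exact: pi_continuous. Qed.

Lemma qproj_open (U : set H) : open U -> open (qproj @` U).
Proof.
move=> oU; rewrite /open /= /quotient_open /=.
have -> : \pi_quotg%qT @^-1` (qproj @` U) =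
    \bigcup_(n in (N : set H)) (fun x => x * n) @^-1` U.
  apply/seteqP; split=> x /=.
    move=> [u Uu /qprojP Nux]; exists (u^-1 * x)^-1; first exact: nsubV.
    by rewrite /= invgM invgK mulVKg.
  move=> [n Nn /= Uxn]; exists (x * n) => //; apply/qprojP.
  by rewrite invgM mulgVK; exact: nsubV.
have cn (n : H) : continuous (fun x => x * n).
  by apply: (@continuous_mulg H H id (fun=> n)) => y; [exact: cvg_id|exact: cvg_cst].
by apply: bigcup_open => n Nn; apply: open_comp => // x _; exact: cn.
Qed.

Lemma mulq_continuous : continuous (fun x : quotg * quotg => x.1 * x.2).
Proof.
move=> [x y] U; rewrite {1}nbhsE => -[W [oW /= Wxy] WU].
have oV : open (qproj @^-1` W) by apply: open_comp => // z _; exact: qproj_continuous.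
have Vxy : nbhs (repr x * repr y) (qproj @^-1` W).
  by apply: open_nbhs_nbhs; split => //=; rewrite qprojM !qprojK.
have [[A B] [/= nA nB] AB] := @mulg_continuous H (repr x, repr y) _ Vxy.
move: nA; rewrite {1}nbhsE => -[A' [oA' A'x] A'A].
move: nB; rewrite {1}nbhsE => -[B' [oB' B'y] B'B].
rewrite nbhs_simpl; exists (qproj @` A', qproj @` B') => /=.
  split; apply: open_nbhs_nbhs; split; try exact: qproj_open.
    by exists (repr x) => //; exact: qprojK.
  by exists (repr y) => //; exact: qprojK.
move=> [_ _] /= [[a A'a <-] [b B'b <-]]; apply: WU => /=.
by have := AB (a, b) (conj (A'A _ A'a) (B'B _ B'b)); rewrite /= qprojM.
Qed.

Lemma invq_continuous : continuous (fun x : quotg => x^-1).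
Proof.
apply/quotient_continuous.
have -> : (fun x : quotg => x^-1) \o \pi_quotg%qT = qproj \o (fun x : H => x^-1).
  by apply/funext => x /=; rewrite qprojV.
move=> x; apply: continuous_comp; first exact: invg_continuous.
exact: qproj_continuous.
Qed.

HB.instance Definition _ :=
  isTopologicalGroup.Build quotg mulq_continuous invq_continuous.

End Quotient.

Section QuotientEpi.
Variables (H G : topGroupType) (p : epi H G) (N : normalSubgroup H).
Hypothesis NK : nsub N `<=` ker p.

Definition quot_map of nsub N `<=` ker p := fun x : quotg N => p (repr x).

Lemma quot_map_qproj x : quot_map NK (qproj N x) = p x.
Proof.
have /NK := repr_qproj N x; rewrite /ker /= gmulfM gmulfV => e.
by rewrite /quot_map -[RHS]mulg1 -e mulVKg.
Qed.

Lemma quot_mapF : {morph quot_map NK : x y / x / y}.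
Proof.
move=> x y; rewrite -[x]qprojK -[y]qprojK.
have -> : qproj N (repr x) / qproj N (repr y) = qproj N (repr x / repr y).
  by rewrite qprojM qprojV.
by rewrite !quot_map_qproj gmulfF.
Qed.

HB.instance Definition _ :=
  isGroupMorphism.Build (quotg N) G (quot_map NK) quot_mapF.

Lemma quot_map_continuous : continuous (quot_map NK).
Proof.
apply/quotient_continuous.
have -> : quot_map NK \o \pi_(quotg N)%qT = p.
  by apply/funext => x /=; rewrite quot_map_qproj.
exact: epi_continuous.
Qed.

Lemma quot_map_surj y : exists x, quot_map NK x = y.
Proof. by have [x <-] := epi_surj p y; exists (qproj N x); rewrite quot_map_qproj. Qed.

Definition quot_epi : epi (quotg N) G := Epi quot_map_continuous quot_map_surj.

End QuotientEpi.

Local Open Scope ring_scope.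

(* Modules are written additively, with a left action.  Joint continuity of
   the action is the separate predicate [continuous_action]: it is required of
   finite simple modules below, and for kernels of epimorphisms of profinite
   groups it is a consequence of compactness. *)
HB.mixin Record isGModule (G : topGroupType) A of TopologicalZmodule A := {
  act : G -> A -> A;
  act1 : forall a, act 1%g a = a;
  actM : forall g h a, act (g * h)%g a = act g (act h a);
  actD : forall g a b, act g (a + b) = act g a + act g b
}.

#[short(type="gmodType")]
HB.structure Definition GModule (G : topGroupType) :=
  {A of TopologicalZmodule A & isGModule G A}.

Section GModuleTheory.
Variables (G : topGroupType) (A : gmodType G).

Lemma act0 (g : G) : act g (0 : A) = 0.
Proof. by apply: (addIr (act g 0)); rewrite -actD !add0r. Qed.

Lemma actN (g : G) (a : A) : act g (- a) = - act g a.
Proof. by apply: (addIr (act g a)); rewrite -actD !addNr act0. Qed.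

Lemma actB (g : G) (a b : A) : act g (a - b) = act g a - act g b.
Proof. by rewrite actD actN. Qed.

Definition continuous_action : Prop :=
  continuous (fun x : G * A => act x.1 x.2).

Definition simple_gmod : Prop :=
  (exists a : A, a != 0) /\
  forall S : set A, S 0 -> (forall a b, S a -> S b -> S (a - b)) ->
    (forall (g : G) a, S a -> S (act g a)) -> S = [set 0] \/ S = setT.

Definition finite_simple_gmod : Prop :=
  [/\ finite_set [set: A], forall a : A, open [set a], continuous_action
    & simple_gmod].

End GModuleTheory.

Section GHom.
Variables (G : topGroupType) (B A : gmodType G).

Definition ghom_pred : {pred B -> A} :=
  fun f => `[< [/\ {morph f : x y / x + y}, continuous f
                 & forall g x, f (act g x) = act g (f x)] >].

Lemma ghom_zmod_closed : GRing.zmod_closed ghom_pred.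
Proof.
split=> [|f g /asboolP[fD fc fg] /asboolP[gD gc gg]]; apply/asboolP.
  split=> [x y||g x]; rewrite ?addr0 //= ?act0 //.
  by move=> x; exact: cvg_cst.
split=> [x y|x|h x].
- by rewrite /= !addrfctE !opprfctE fD gD opprD addrACA.
- apply: (@continuous_comp _ _ _ (fun x => (f x, g x)) (fun z : A * A => z.1 - z.2)).
    by apply: cvg_pair; [exact: fc|exact: gc].
  exact: sub_continuous.
- by rewrite /= !addrfctE !opprfctE fg gg actB.
Qed.

HB.instance Definition _ :=
  GRing.isZmodClosed.Build (B -> A) ghom_pred ghom_zmod_closed.

Definition ghom := {f : B -> A | ghom_pred f}.
HB.instance Definition _ := SubType.on ghom.
HB.instance Definition _ := Choice.on ghom.
HB.instance Definition _ := [SubChoice_isSubZmodule of ghom by <:].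

Definition ghom_fun (f : ghom) : B -> A := val f.

End GHom.

Coercion ghom_fun : ghom >-> Funclass.

Section GHomTheory.
Variables (G : topGroupType).
Implicit Types A B C : gmodType G.

Lemma ghomP B A (f : ghom B A) :
  [/\ {morph f : x y / x + y}, continuous f & forall g x, f (act g x) = act g (f x)].
Proof. by apply/asboolP; exact: (valP f). Qed.

Lemma ghomE B A (f g : ghom B A) : f =1 g -> f = g.
Proof. by move=> fg; apply/val_inj/funext. Qed.

Lemma ghomD B A (f : ghom B A) x y : f (x + y) = f x + f y.
Proof. by case: (ghomP f). Qed.

Lemma ghom_continuous B A (f : ghom B A) : continuous f.
Proof. by case: (ghomP f). Qed.

Lemma ghom_act B A (f : ghom B A) g x : f (act g x) = act g (f x).
Proof. by case: (ghomP f). Qed.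

Lemma ghom0 B A (f : ghom B A) : f 0 = 0.
Proof. by apply: (addIr (f 0)); rewrite -ghomD !add0r. Qed.

Lemma ghomN B A (f : ghom B A) x : f (- x) = - f x.
Proof. by apply: (addIr (f x)); rewrite -ghomD !addNr ghom0. Qed.

Lemma add_ghomE B A (f g : ghom B A) x : (f + g : ghom B A) x = f x + g x.
Proof. by []. Qed.

Lemma id_ghom_subproof A : ghom_pred (@id A).
Proof. by apply/asboolP; split=> // x; exact: cvg_id. Qed.

Definition id_ghom A : ghom A A := Sub (@id A) (id_ghom_subproof A).

Lemma comp_ghom_subproof C B A (g : ghom B A) (f : ghom C B) : ghom_pred (g \o f).
Proof.
apply/asboolP; split=> [x y|x|h x] /=; rewrite ?ghomD ?ghom_act //.
by apply: continuous_comp; exact: ghom_continuous.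
Qed.

Definition comp_ghom C B A (g : ghom B A) (f : ghom C B) : ghom C A :=
  Sub (g \o f) (comp_ghom_subproof g f).

Definition gmod_isom B A (f : ghom B A) : Prop :=
  exists f' : ghom A B, cancel f f' /\ cancel f' f.

Definition gmod_iso B A : Prop := exists f : ghom B A, gmod_isom f.

End GHomTheory.

Section GEnd.
Variables (G : topGroupType) (A : gmodType G).

Definition gend := ghom A A.
HB.instance Definition _ := GRing.Zmodule.on gend.

Lemma gend_mulA : associative (fun f g : gend => comp_ghom f g).
Proof. by move=> f g h; apply: ghomE. Qed.
Lemma gend_mul1 : left_id (id_ghom A : gend) (fun f g : gend => comp_ghom f g).
Proof. by move=> f; apply: ghomE. Qed.
Lemma gend_1mul : right_id (id_ghom A : gend) (fun f g : gend => comp_ghom f g).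
Proof. by move=> f; apply: ghomE. Qed.
Lemma gend_mulDl : left_distributive (fun f g : gend => comp_ghom f g) +%R.
Proof. by move=> f g h; apply: ghomE. Qed.
Lemma gend_mulDr : right_distributive (fun f g : gend => comp_ghom f g) +%R.
Proof. by move=> f g h; apply: ghomE => x; rewrite /= add_ghomE /= /ghom_fun /= ghomD. Qed.

HB.instance Definition _ := GRing.Zmodule_isPzRing.Build gend
  gend_mulA gend_mul1 gend_1mul gend_mulDl gend_mulDr.

Variable B : gmodType G.

Lemma ghom_scaleA (f g : gend) (v : ghom B A) :
  comp_ghom f (comp_ghom g v) = comp_ghom (f * g) v.
Proof. exact: ghomE. Qed.
Lemma ghom_scale1 : left_id (1 : gend) (fun f (v : ghom B A) => comp_ghom f v).
Proof. by move=> v; apply: ghomE. Qed.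
Lemma ghom_scaleDr :
  right_distributive (fun (f : gend) (v : ghom B A) => comp_ghom f v) +%R.
Proof. by move=> f u v; apply: ghomE => x; rewrite /= add_ghomE /= /ghom_fun /= ghomD. Qed.
Lemma ghom_scaleDl (v : ghom B A) : {morph (fun f : gend => comp_ghom f v) : f g / f + g}.
Proof. by move=> f g; apply: ghomE. Qed.

HB.instance Definition _ := GRing.Zmodule_isLmodule.Build gend (ghom B A)
  ghom_scaleA ghom_scale1 ghom_scaleDr ghom_scaleDl.

End GEnd.

Definition is_basis (K : pzRingType) (V : lmodType K) (I : choiceType) (e : I -> V) :=
  (forall c : I -> K, finite_set [set i | c i != 0] ->
     \sum_(i \in [set: I]) c i *: e i = 0 -> forall i, c i = 0) /\
  (forall v : V, exists2 c : I -> K, finite_set [set i | c i != 0]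
     & v = \sum_(i \in [set: I]) c i *: e i).

Section KerMod.
Variables (E G : topGroupType) (p : epi E G).

Definition lift (g : G) : E := projT1 (cid (epi_surj p g)).

Lemma liftK g : p (lift g) = g.
Proof. exact: (projT2 (cid (epi_surj p g))). Qed.

Variable ab : abelian_ker p.

Definition kerMod of abelian_ker p : Type := set_type (ker p).
Local Notation K := (kerMod ab).
HB.instance Definition _ := SubType.on K.
HB.instance Definition _ := Choice.on K.
HB.instance Definition _ := Topological.on K.

Lemma kerModP (x : K) : p (val x) = 1%g.
Proof. by have /set_mem := valP x. Qed.

Lemma kerModJ_subproof (x : K) (h : E) : (h * val x * h^-1)%g \in ker p.
Proof. by apply/mem_set; rewrite /ker /= !gmulfM gmulfV kerModP mulg1 mulgV. Qed.

Lemma kerModM_subproof (x y : K) : (val x * val y)%g \in ker p.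
Proof. by apply/mem_set; rewrite /ker /= gmulfM !kerModP mulg1. Qed.

Lemma kerModV_subproof (x : K) : (val x)^-1%g \in ker p.
Proof. by apply/mem_set; rewrite /ker /= gmulfV !kerModP invg1. Qed.

Lemma kerMod1_subproof : 1%g \in ker p.
Proof. by apply/mem_set; rewrite /ker /= gmulf1. Qed.

Definition kerMod_add (x y : K) : K := Sub (val x * val y)%g (kerModM_subproof x y).
Definition kerMod_opp (x : K) : K := Sub (val x)^-1%g (kerModV_subproof x).
Definition kerMod_zero : K := Sub 1%g kerMod1_subproof.

Lemma kerMod_addA : associative kerMod_add.
Proof. by move=> x y z; apply/val_inj; rewrite /= mulgA. Qed.
Lemma kerMod_addC : commutative kerMod_add.
Proof. by move=> x y; apply/val_inj/ab; exact: kerModP. Qed.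
Lemma kerMod_add0 : left_id kerMod_zero kerMod_add.
Proof. by move=> x; apply/val_inj; rewrite /= mul1g. Qed.
Lemma kerMod_addN : left_inverse kerMod_zero kerMod_opp kerMod_add.
Proof. by move=> x; apply/val_inj; rewrite /= mulVg. Qed.

HB.instance Definition _ := GRing.isZmodule.Build K
  kerMod_addA kerMod_addC kerMod_add0 kerMod_addN.

Lemma val_kerMod_continuous : continuous (val : K -> E).
Proof. exact: initial_continuous. Qed.

Lemma kerMod_continuous (T : topologicalType) (f : T -> K) :
  continuous (val \o f) -> continuous f.
Proof. by move=> /continuousP cf; apply/continuousP => _ [U oU <-]; exact: cf. Qed.

Lemma kerMod_sub_continuous : continuous (fun x : K * K => x.1 - x.2).
Proof.
apply: kerMod_continuous.
apply: (@continuous_mulg _ _ (fun x : K * K => val x.1) (fun x : K * K => (val x.2)^-1%g)).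
  move=> x; apply: continuous_comp; [exact: cvg_fst|exact: val_kerMod_continuous].
apply: (@continuous_invg _ _ (fun x : K * K => val x.2)).
move=> x; apply: continuous_comp; [exact: cvg_snd|exact: val_kerMod_continuous].
Qed.

HB.instance Definition _ :=
  PreTopologicalNmodule_isTopologicalZmodule.Build K kerMod_sub_continuous.

Definition kerMod_conj (h : E) (x : K) : K := Sub (h * val x * h^-1)%g (kerModJ_subproof x h).
Definition kerMod_act (g : G) (x : K) : K := kerMod_conj (lift g) x.

Lemma kerMod_actE (h : E) (x : K) : kerMod_act (p h) x = kerMod_conj h x.
Proof.
apply/val_inj => /=; set l := lift _.
have lh : ker p (h^-1 * l)%g by rewrite /ker /= gmulfM gmulfV liftK mulVg.
have := ab lh (kerModP x); rewrite /commute => /(congr1 (fun z => h * z * l^-1)%g).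
by rewrite !mulgA mulgV mul1g => ->; rewrite mulgK.
Qed.

Lemma kerMod_act1 x : kerMod_act 1%g x = x.
Proof.
by have := kerMod_actE 1%g x; rewrite gmulf1 => ->; apply/val_inj; rewrite /= mul1g invg1 mulg1.
Qed.

Lemma kerMod_actM g h x : kerMod_act (g * h)%g x = kerMod_act g (kerMod_act h x).
Proof.
rewrite -[g in LHS]liftK -[h in LHS]liftK -gmulfM kerMod_actE.
by apply/val_inj; rewrite /= invgM !mulgA.
Qed.

Lemma kerMod_actD g x y : kerMod_act g (x + y) = kerMod_act g x + kerMod_act g y.
Proof. by apply/val_inj; rewrite /= !mulgA mulgVK. Qed.

HB.instance Definition _ :=
  isGModule.Build G K kerMod_act1 kerMod_actM kerMod_actD.

End KerMod.

Section Cohomology.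
Variables (G : topGroupType) (A : gmodType G).

Definition cocycle2_pred : {pred G * G -> A} := fun f =>
  `[< continuous f /\ forall r s t,
        act r (f (s, t)) - f ((r * s)%g, t) + f (r, (s * t)%g) - f (r, s) = 0 >].

Lemma cocycle2_zmod_closed : GRing.zmod_closed cocycle2_pred.
Proof.
split=> [|f g /asboolP[fc fZ] /asboolP[gc gZ]]; apply/asboolP.
  split=> [x|r s t]; first exact: cvg_cst.
  by rewrite /= act0 !subr0 addr0.
split=> [x|r s t].
  apply: (@continuous_comp _ _ _ (fun x => (f x, g x)) (fun z : A * A => z.1 - z.2)).
    by apply: cvg_pair; [exact: fc|exact: gc].
  exact: sub_continuous.
rewrite !addrfctE !opprfctE actB -[RHS](subr0 0) -{1}(fZ r s t) -(gZ r s t).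
by rewrite !opprD !opprK (addrACA (act r _)) (addrACA (_ - _)) (addrACA (_ - _ + _)).
Qed.

HB.instance Definition _ :=
  GRing.isZmodClosed.Build (G * G -> A) cocycle2_pred cocycle2_zmod_closed.

Definition Z2 := {f : G * G -> A | cocycle2_pred f}.
HB.instance Definition _ := SubType.on Z2.
HB.instance Definition _ := Choice.on Z2.
HB.instance Definition _ := [SubChoice_isSubZmodule of Z2 by <:].

Definition coboundary2_pred : {pred Z2} := fun f =>
  `[< exists2 c : G -> A, continuous c &
        forall s t, val f (s, t) = act s (c t) - c (s * t)%g + c s >].

Lemma coboundary2_zmod_closed : GRing.zmod_closed coboundary2_pred.
Proof.
split=> [|f g /asboolP[c cc fc] /asboolP[d dc gd]]; apply/asboolP.
  by exists (fun=> 0) => [x|s t]; [exact: cvg_cst|rewrite /= act0 subr0 addr0].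
exists (fun x => c x - d x) => [x|s t].
  apply: (@continuous_comp _ _ _ (fun x => (c x, d x)) (fun z : A * A => z.1 - z.2)).
    by apply: cvg_pair; [exact: cc|exact: dc].
  exact: sub_continuous.
rewrite /= !addrfctE !opprfctE fc gd actB.
by rewrite !opprD !opprK (addrACA (act s _)) (addrACA (_ - _)).
Qed.

HB.instance Definition _ :=
  GRing.isZmodClosed.Build Z2 coboundary2_pred coboundary2_zmod_closed.

Definition H2 := Quotient.quot coboundary2_pred.
HB.instance Definition _ := Choice.on H2.
HB.instance Definition _ := GRing.Zmodule.on H2.
HB.instance Definition _ := Quotient.on H2.

Definition class2 (f : Z2) : H2 := \pi_H2%qT f.

Lemma class2P (f g : Z2) : class2 f = class2 g <-> f - g \in coboundary2_pred.
Proof. by rewrite Quotient.idealrBE; split=> [e|/eqP//]; apply/eqP. Qed.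

End Cohomology.

Section H2map.
Variables (G : topGroupType) (B A : gmodType G) (phi : ghom B A).

Lemma Z2map_subproof (f : Z2 B) : cocycle2_pred (phi \o val f).
Proof.
have /asboolP[fc fZ] := valP f; apply/asboolP; split=> [x|r s t] /=.
  by apply: continuous_comp; [exact: fc|exact: ghom_continuous].
by rewrite -ghom_act -!ghomN -!ghomD fZ ghom0.
Qed.

Definition Z2map (f : Z2 B) : Z2 A := Sub (phi \o val f) (Z2map_subproof f).

Definition H2map (c : H2 B) : H2 A := class2 (Z2map (repr c)).

Lemma H2map_class (f : Z2 B) : H2map (class2 f) = class2 (Z2map f).
Proof.
rewrite /H2map; set f' := repr _.
have /class2P/asboolP[c cc fc] : class2 f' = class2 f by rewrite /class2 reprK.
apply/class2P/asboolP.
exists (phi \o c) => [x|s t].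
  by apply: continuous_comp; [exact: cc|exact: ghom_continuous].
rewrite -[RHS]/(act s (phi (c t)) - phi (c (s * t)%g) + phi (c s)).
by rewrite -ghom_act -!ghomN -!ghomD -fc /= ghomD ghomN.
Qed.

End H2map.

Section ExtensionClass.
Variables (E G : topGroupType) (p : epi E G) (ab : abelian_ker p).

Section Cocycle.
Variables (u : G -> E) (uc : continuous u) (up : cancel u p).

Lemma section_ker_subproof (s t : G) : (u s * u t * (u (s * t))^-1)%g \in ker p.
Proof. by apply/mem_set; rewrite /ker /= !gmulfM gmulfV !up mulgV. Qed.

Definition section_defect (st : G * G) : kerMod ab :=
  Sub (u st.1 * u st.2 * (u (st.1 * st.2))^-1)%g (section_ker_subproof st.1 st.2).

Lemma section_defect_cocycle : cocycle2_pred section_defect.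
Proof.
apply/asboolP; split.
  apply: kerMod_continuous.
  have u1 : continuous (fun x : G * G => u x.1).
    by move=> x; apply: continuous_comp; [exact: cvg_fst|exact: uc].
  have u2 : continuous (fun x : G * G => u x.2).
    by move=> x; apply: continuous_comp; [exact: cvg_snd|exact: uc].
  apply: (@continuous_mulg _ _ (fun x : G * G => u x.1 * u x.2)%g
            (fun x : G * G => (u (x.1 * x.2))^-1)%g); first exact: continuous_mulg.
  apply: (@continuous_invg _ _ (fun x : G * G => u (x.1 * x.2)%g)) => x.
  by apply: continuous_comp; [exact: mulg_continuous|exact: uc].
move=> r s t; rewrite -[r in act r]up /act /= kerMod_actE.
have abcd (V : zmodType) (a b c d : V) : a + c = d + b -> a - b + c - d = 0.
  by move=> e; rewrite (addrAC a) e addrK subrr.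
apply: abcd; apply/val_inj => /=.
by rewrite !mulgA !mulgVK.
Qed.

Definition section_cocycle : Z2 (kerMod ab) := Sub section_defect section_defect_cocycle.

End Cocycle.

(* The class of [(s, t) |-> u s * u t * (u (s * t))^-1] for a continuous section
   [u].  Over profinite groups continuous sections exist, and the class does not
   depend on the section: the default value is not used. *)
Definition ext_class : H2 (kerMod ab) :=
  xget 0 [set c | exists (u : G -> E) (uc : continuous u) (up : cancel u p),
                    c = class2 (section_cocycle uc up)].

End ExtensionClass.

(* The transport of the class of [eta] along an isomorphism of [G]-modules from
   its kernel to [A] is [c]. *)
Definition extension_of_class (E G : topGroupType) (eta : epi E G) (A : gmodType G)
    (c : H2 A) : Prop :=
  exists (ab : abelian_ker eta) (theta : ghom (kerMod ab) A),
    gmod_isom theta /\ H2map theta (ext_class ab) = c.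

Section FiberProduct.
Variables (G : topGroupType) (I : Type) (E : I -> topGroupType).
Variable eta : forall i, epi (E i) G.

(* A point carries its image in [G] together with its coordinates: this is the
   set of compatible families when [I] is inhabited ([fibprod_uniq] below), and
   is [G] when [I] is empty. *)
Definition fibprod_set : set (G * prod_topology (fun i => E i : topologicalType)) :=
  [set x | forall i, eta i (x.2 i) = x.1].

Definition fibprod : Type := set_type fibprod_set.
HB.instance Definition _ := SubType.on fibprod.
HB.instance Definition _ := Choice.on fibprod.
HB.instance Definition _ := Topological.on fibprod.

Definition fibprod_base (x : fibprod) : G := (val x).1.
Definition fibprod_coord (x : fibprod) : forall i, E i := (val x).2.

Lemma fibprodP x i : eta i (fibprod_coord x i) = fibprod_base x.
Proof. by have /set_mem := valP x; exact. Qed.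

Definition mk_fibprod (g : G) (h : forall i, E i)
    (gh : forall i, eta i (h i) = g) : fibprod :=
  Sub (g, h : prod_topology _) (mem_set (gh : fibprod_set (g, h))).

Lemma fibprod_eq x y :
  fibprod_base x = fibprod_base y ->
  (forall i, fibprod_coord x i = fibprod_coord y i) -> x = y.
Proof.
move=> xy1 xy2; apply/val_inj.
rewrite [LHS]surjective_pairing [RHS]surjective_pairing; congr (_, _) => //.
exact: functional_extensionality_dep.
Qed.

Lemma fibprod_uniq (i0 : I) (h : forall i, E i) :
  (forall i j, eta i (h i) = eta j (h j)) ->
  exists! x : fibprod, forall i, fibprod_coord x i = h i.
Proof.
move=> hE; have hb i : eta i (h i) = eta i0 (h i0) by [].
exists (mk_fibprod hb); split=> // x xh; apply: fibprod_eq => // .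
by rewrite -(fibprodP x i0) xh.
Qed.

Lemma fibprod_mul_subproof x y i :
  eta i (fibprod_coord x i * fibprod_coord y i)%g = (fibprod_base x * fibprod_base y)%g.
Proof. by rewrite gmulfM !fibprodP. Qed.
Lemma fibprod_inv_subproof x i :
  eta i (fibprod_coord x i)^-1%g = (fibprod_base x)^-1%g.
Proof. by rewrite gmulfV fibprodP. Qed.
Lemma fibprod_one_subproof i : eta i 1%g = 1%g.
Proof. exact: gmulf1. Qed.

Definition fibprod_mul x y : fibprod := mk_fibprod (fibprod_mul_subproof x y).
Definition fibprod_inv x : fibprod := mk_fibprod (fibprod_inv_subproof x).
Definition fibprod_one : fibprod := mk_fibprod fibprod_one_subproof.

Lemma fibprod_mulA : associative fibprod_mul.
Proof. by move=> x y z; apply: fibprod_eq => [|i]; exact: mulgA. Qed.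
Lemma fibprod_mul1 : left_id fibprod_one fibprod_mul.
Proof. by move=> x; apply: fibprod_eq => [|i]; exact: mul1g. Qed.
Lemma fibprod_1mul : right_id fibprod_one fibprod_mul.
Proof. by move=> x; apply: fibprod_eq => [|i]; exact: mulg1. Qed.
Lemma fibprod_mulV : left_inverse fibprod_one fibprod_inv fibprod_mul.
Proof. by move=> x; apply: fibprod_eq => [|i]; exact: mulVg. Qed.
Lemma fibprod_Vmul : right_inverse fibprod_one fibprod_inv fibprod_mul.
Proof. by move=> x; apply: fibprod_eq => [|i]; exact: mulgV. Qed.

HB.instance Definition _ := isGroup.Build fibprod
  fibprod_mulA fibprod_mul1 fibprod_1mul fibprod_mulV fibprod_Vmul.

Lemma fibprod_base_continuous : continuous fibprod_base.
Proof.
move=> x; apply: (@continuous_comp _ _ _ (val : fibprod -> _) fst).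
  exact: initial_continuous.
exact: cvg_fst.
Qed.

Lemma fibprod_coord_continuous i : continuous (fun x => fibprod_coord x i).
Proof.
move=> x; apply: (@continuous_comp _ _ _ (val : fibprod -> _)
  (fun z : _ * prod_topology (fun i => E i : topologicalType) => z.2 i)).
  exact: initial_continuous.
apply: (@continuous_comp _ _ _ snd
  (fun z : prod_topology (fun i => E i : topologicalType) => z i)).
  exact: cvg_snd.
exact: (@proj_continuous {classic I} (fun i => E i : topologicalType) i).
Qed.

Lemma fibprod_continuous (T : topologicalType) (f : T -> fibprod) :
  continuous (fibprod_base \o f) ->
  (forall i, continuous (fun t => fibprod_coord (f t) i)) -> continuous f.
Proof.
move=> fb fc; pose P : topologicalType := prod_topology (fun i => E i : topologicalType).
have fP : continuous (fun t => fibprod_coord (f t) : P).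
  move=> t; apply/cvg_sup => i U [_ [[W oW <-] Wi WU]]; apply: (filterS WU).
  by apply: (fc i t W); exact: open_nbhs_nbhs.
have /continuousP vf : continuous (val \o f).
  have -> : val \o f = (fun t => (fibprod_base (f t), fibprod_coord (f t) : P)).
    by apply/funext => t; rewrite /= [LHS]surjective_pairing.
  by move=> t; have := cvg_pair (fb t) (fP t); apply; exact: nbhs_filter.
by apply/continuousP => _ [U oU <-]; exact: vf.
Qed.

Lemma fibprod_mul_continuous : continuous (fun x : fibprod * fibprod => (x.1 * x.2)%g).
Proof.
apply: fibprod_continuous => [|i].
  apply: (@continuous_mulg _ _ (fun x : fibprod * fibprod => fibprod_base x.1)
            (fun x => fibprod_base x.2)) => x.
    by apply: continuous_comp; [exact: cvg_fst|exact: fibprod_base_continuous].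
  by apply: continuous_comp; [exact: cvg_snd|exact: fibprod_base_continuous].
apply: (@continuous_mulg _ _ (fun x : fibprod * fibprod => fibprod_coord x.1 i)
          (fun x => fibprod_coord x.2 i)) => x.
  apply: (@continuous_comp _ _ _ fst (fun z => fibprod_coord z i)).
    exact: cvg_fst.
  exact: fibprod_coord_continuous.
apply: (@continuous_comp _ _ _ snd (fun z => fibprod_coord z i)).
  exact: cvg_snd.
exact: fibprod_coord_continuous.
Qed.

Lemma fibprod_inv_continuous : continuous (fun x : fibprod => x^-1%g).
Proof.
apply: fibprod_continuous => [|i]; apply: continuous_invg.
  exact: fibprod_base_continuous.
exact: fibprod_coord_continuous.
Qed.

HB.instance Definition _ := isTopologicalGroup.Build fibprod
  fibprod_mul_continuous fibprod_inv_continuous.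

Lemma fibprod_baseF : {morph fibprod_base : x y / (x / y)%g}.
Proof. by []. Qed.
HB.instance Definition _ := isGroupMorphism.Build fibprod G fibprod_base fibprod_baseF.

Lemma fibprod_base_surj g : exists x, fibprod_base x = g.
Proof. by exists (mk_fibprod (fun i => liftK (eta i) g)). Qed.

Definition fibprod_epi : epi fibprod G := Epi fibprod_base_continuous fibprod_base_surj.

End FiberProduct.

Section SumFamily.
Variables (G : topGroupType) (I J : Type).
Variables (E : I -> topGroupType) (F : J -> topGroupType).
Variables (eta : forall i, epi (E i) G) (theta : forall j, epi (F j) G).

Definition sum_group (k : I + J) : topGroupType :=
  match k with inl i => E i | inr j => F j end.

Definition sum_epi (k : I + J) : epi (sum_group k) G :=
  match k with inl i => eta i | inr j => theta j end.

End SumFamily.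

Definition fibprod2_epi (G E F : topGroupType) (eta : epi E G) (theta : epi F G) :=
  fibprod_epi (sum_epi (fun _ : unit => eta) (fun _ : unit => theta)).

(* A system of representatives, indexed by [L], of the isomorphism classes of
   indecomposable epimorphisms onto [G] with non-abelian kernel. *)
Definition Lambda_na (G : profiniteGroupType) (L : Type) (E : L -> profiniteGroupType)
    (zeta : forall l, epi (E l) G) : Prop :=
  (forall l, indecomposable (zeta l) /\ ~ abelian_ker (zeta l)) /\
  (forall (F : profiniteGroupType) (p : epi F G),
     indecomposable p -> ~ abelian_ker p -> exists! l, iso_over p (zeta l)).

(* A system of representatives, indexed by [L], of the isomorphism classes of
   finite simple [G]-modules. *)
Definition Lambda_ab (G : profiniteGroupType) (L : Type) (A : L -> gmodType G) : Prop :=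
  (forall l, finite_simple_gmod (A l)) /\
  (forall B : gmodType G, finite_simple_gmod B -> exists! l, gmod_iso B (A l)).

Section Isotypic.
Variables (H G : profiniteGroupType) (p : epi H G).

Section Intersection.
Variable C : set (normalSubgroup H).

Definition ker_bigcap_set : set H := ker p `&` \bigcap_(N in C) nsub N.

Lemma ker_bigcap1 : ker_bigcap_set 1%g.
Proof. by split=> [|N _]; [exact: gmulf1|exact: nsub1]. Qed.

Lemma ker_bigcapM x y :
  ker_bigcap_set x -> ker_bigcap_set y -> ker_bigcap_set (x * y)%g.
Proof.
move=> [px Nx] [py Ny]; split=> [|N CN].
  by rewrite /ker /= gmulfM px py mulg1.
by apply: nsubM; [exact: Nx|exact: Ny].
Qed.

Lemma ker_bigcapV x : ker_bigcap_set x -> ker_bigcap_set x^-1%g.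
Proof.
move=> [px Nx]; split=> [|N CN]; first by rewrite /ker /= gmulfV px invg1.
by apply: nsubV; exact: Nx.
Qed.

Lemma ker_bigcapJ x y : ker_bigcap_set x -> ker_bigcap_set (x ^ y)%g.
Proof.
move=> [px Nx]; split=> [|N CN]; first by rewrite /ker /= gmulfJ px conj1g.
by apply: nsubJ; exact: Nx.
Qed.

Lemma ker_bigcap_closed : closed ker_bigcap_set.
Proof.
apply: closedI; last by apply: closed_bigI => N _; exact: nsub_closed.
have /continuous_closedP/(_ [set 1%g]) := @epi_continuous _ _ p; apply.
exact/accessible_closed_set1/hausdorff_accessible/profinite_hausdorff.
Qed.

(* For nonempty [C], a family of subgroups of [Ker p], the intersection of [C];
   for empty [C], [Ker p]. *)
Definition ker_bigcap : normalSubgroup H :=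
  NormalSubgroup ker_bigcap1 ker_bigcapM ker_bigcapV ker_bigcapJ ker_bigcap_closed.

Lemma ker_bigcap_sub : nsub ker_bigcap `<=` ker p.
Proof. by move=> x []. Qed.

End Intersection.

Section NonAbelian.
Variables (E : profiniteGroupType) (zeta : epi E G).

Definition C_na : set (normalSubgroup H) :=
  [set N | exists NK : nsub N `<=` ker p, iso_over (quot_epi NK) zeta].

Definition H_na : topGroupType := quotg (ker_bigcap C_na).

Definition pi_na : epi H_na G := quot_epi (@ker_bigcap_sub C_na).

End NonAbelian.

Section Abelian.
Variable A : gmodType G.

Definition C_ab : set (normalSubgroup H) :=
  [set N | exists (NK : nsub N `<=` ker p) (ab : abelian_ker (quot_epi NK)),
             gmod_iso (kerMod ab) A].

Definition H_ab : topGroupType := quotg (ker_bigcap C_ab).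

Definition pi_ab : epi H_ab G := quot_epi (@ker_bigcap_sub C_ab).

Lemma pi_ab_abelian : abelian_ker pi_ab.
Proof.
move=> x y; rewrite -[x]qprojK -[y]qprojK; move: (repr x) (repr y) => {x y} x y.
rewrite /ker /= !quot_map_qproj => px py.
rewrite /commute -!qprojM; apply/qprojP; split=> [|N [NK [ab _]]].
  by rewrite /ker /= !gmulfM gmulfV gmulfM px py !mulg1 invg1.
have kN z : p z = 1%g -> ker (quot_epi NK) (qproj N z).
  by rewrite /ker /= quot_map_qproj.
by apply/qprojP; rewrite !qprojM; apply: ab; exact: kN.
Qed.

Definition B_ab : gmodType G := kerMod pi_ab_abelian.

Definition f_ab : H2 B_ab := ext_class pi_ab_abelian.

Definition B_dual : lmodType (gend A) := ghom B_ab A.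

Definition S_ab (phi : B_dual) : H2 A := H2map (phi : ghom B_ab A) f_ab.

End Abelian.

End Isotypic.

(* Main.v *)
From HB Require Import structures.
Require Import Defs.
From mathcomp Require Import all_boot all_algebra.
From mathcomp Require Import all_classical topology tvs.

Set Implicit Arguments.
Unset Strict Implicit.
Unset Printing Implicit Defensive.

Import GRing.Theory.

Local Open Scope classical_set_scope.
Local Open Scope group_scope.

(** Let [K] be the kernel of [p].  A maximal element [N] among the normal
    subgroups of [H] strictly inside [K] has a quotient [H / N -> G] whose kernel
    is a minimal normal subgroup, hence finite.  If this kernel is abelian it is
    a finite simple [G]-module and [N] belongs to one [C_ab]; otherwise
    [H / N -> G] is indecomposable and [N] belongs to one [C_na].  The subgroups
    [N] intersect trivially because [p] is fundamental, so [H] embeds into the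
    fiber product of its components ([components_inj]).

    The point is surjectivity.  By compactness finitely many coordinates may be
    treated at a time ([fibprod_lift_finite]), and what has to be shown is that
    the subgroups attached to different coordinates generate [K].  This rests on
    [linked_of_cap_sub]: if a finite intersection of maximal subgroups lies in a
    maximal subgroup [N'], then one of them is [N'] itself, or has an abelian
    quotient isomorphic to that of [N'] as a [G]-module.  Hence intersections
    over different components generate [K] ([unlinked_mul_cover]), and so do, in
    a component of non-abelian type, a member and an intersection of other
    members ([na_component_iso]).

    In a component of abelian type [A] the argument is linear algebra over
    [End_G(A)]: a homomorphism to [A] vanishing on the common kernel of finitely
    many others is a combination of them ([common_kernel_span]), so a basis of
    the dual identifies [B_A] with a power of [A].  It remains to extend a
    homomorphism of kernels to the extensions, which is possible exactly when it
    carries one extension class to the other ([hom_of_class]).  Classes are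
    computed with continuous sections.  Over a minimal kernel these exist because
    the projection is a local homeomorphism ([local_section]), and [H_A] inherits
    one from the fiber product of its quotients by the kernels of the members of
    the basis ([abelian_kernel_section]). *)

(** * Compact and totally disconnected spaces *)

Lemma family_choice (I : Type) (T : I -> Type) (P : forall i, T i -> Prop) :
  (forall i, exists t, P i t) -> exists t : forall i, T i, forall i, P i (t i).
Proof.
move=> h; exists (fun i => projT1 (cid (h i))) => i.
exact: (projT2 (cid (h i))).
Qed.

Lemma compact_finite_intersection (T : topologicalType) (I : eqType)
    (f : I -> set T) : compact [set: T] -> (forall i, closed (f i)) ->
  (forall s : seq I, exists x, forall i, i \in s -> f i x) ->
  exists x, forall i, f i x.
Proof.
move=> cT cf fI.
pose B (s : seq I) := [set x | forall i, i \in s -> f i x].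
have FF : Filter (filter_from [set: seq I] B).
  apply: filter_from_filter; first by exists [::].
  move=> s t _ _; exists (s ++ t) => // x Bx.
  by split=> i si; apply: Bx; rewrite mem_cat si ?orbT.
have PF : ProperFilter (filter_from [set: seq I] B).
  by apply: filter_from_proper => s _; have [x] := fI s; exists x.
have [|x [_ clx]] := cT _ PF; first by exists [::].
exists x => i; apply: cf => U Ux.
apply: clx => //; exists [:: i] => // y; apply; exact: mem_head.
Qed.

Lemma compact_image (S T : topologicalType) (f : S -> T) (A : set S) :
  continuous f -> compact A -> compact (f @` A).
Proof. by move=> cf; apply: continuous_compact; exact: continuous_subspaceT. Qed.

Lemma closed_image (S T : topologicalType) (f : S -> T) (A : set S) :
  compact [set: S] -> hausdorff_space T -> continuous f -> closed A ->
  closed (f @` A).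
Proof.
move=> cS hT cf cA; apply: compact_closed => //; apply: compact_image => //.
exact: subclosed_compact cS _.
Qed.

(** A continuous surjection from a compact space onto a Hausdorff space is a
    quotient map. *)
Lemma continuous_factor (R S T : topologicalType) (r : R -> S) (f : S -> T) :
  compact [set: R] -> hausdorff_space S -> continuous r ->
  (forall y, exists x, r x = y) -> continuous (f \o r) -> continuous f.
Proof.
move=> cR hS cr sr cfr; apply/continuous_closedP => C cC.
have -> : f @^-1` C = r @` ((f \o r) @^-1` C).
  apply/seteqP; split=> [y Cy|_ [x Cx <-]//].
  by have [x xy] := sr y; exists x; rewrite /= ?xy.
by apply: closed_image => //; exact: (continuous_closedP _).1.
Qed.

Lemma continuous_inverse (S T : topologicalType) (f : S -> T) (g : T -> S) :
  compact [set: S] -> hausdorff_space T -> continuous f ->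
  cancel f g -> cancel g f -> continuous g.
Proof.
move=> cS hT cf fK gK; apply: (continuous_factor cS hT cf) => [y|x].
  by exists (g y).
have -> : g \o f = id by apply/funext => y /=.
exact: cvg_id.
Qed.

Lemma hausdorff_inj (S T : topologicalType) (f : S -> T) :
  hausdorff_space T -> continuous f -> injective f -> hausdorff_space S.
Proof.
rewrite !open_hausdorff => hT cf fI x y xy.
have [|[A B] [/= xA yB] [oA oB AB]] := hT (f x) (f y).
  by apply: contra_neq xy; exact: fI.
exists (f @^-1` A, f @^-1` B) => /=.
  by split; rewrite inE /=; apply: set_mem.
split; [exact: (continuousP _).1|exact: (continuousP _).1|].
apply/eqP; rewrite -subset0 => z [Az Bz].
by move/eqP: AB => /seteqP[+ _] => /(_ (f z)); apply.
Qed.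

(** In a compact Hausdorff space the clopen neighbourhoods of a point intersect
    in a connected set: a separation of the intersection extends to disjoint
    open sets, hence, by compactness, to one of the clopen neighbourhoods. *)
Lemma totally_disconnected_zero_dimensional (T : topologicalType) :
  compact [set: T] -> hausdorff_space T -> totally_disconnected [set: T] ->
  zero_dimensional T.
Proof.
move=> cT hT tdT x y xy; apply: contrapT => nU.
pose D := [set C : set T | clopen C /\ C x].
pose Q := \bigcap_(C in D) C.
have Qy : Q y.
  by move=> C [cC Cx]; apply: contrapT => nCy; apply: nU; exists C.
have Qx : Q x by move=> C [].
suff cQ : connected Q.
  have : connected_component [set: T] x y by exists Q.
  by rewrite tdT // => yx; rewrite yx eqxx in xy.
have clQ : closed Q by apply: closed_bigI => C [[_ ]].
have split_absurd (A B : set T) : closed A -> closed B -> Q = A `|` B ->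
    A `&` B = set0 -> A x -> B = set0.
  move=> cA cB QAB AB0 Ax.
  have nA : set_nbhs A (~` B).
    apply/set_nbhsP; exists (~` B); split=> //; first exact: closed_openC.
    by move=> z Az Bz; have : (A `&` B) z by []; rewrite AB0.
  have [V nV cV] := compact_normal hT cT cA nA.
  have [U [oU AU UV]] := (set_nbhsP _ _).1 nV.
  pose O := U `|` ~` closure V.
  have oO : open O.
    by apply: openU => //; apply: closed_openC; exact: closed_closure.
  have QO : Q `<=` O.
    by rewrite QAB => z [/AU|Bz]; [left|right=> /cV].
  have [C [[[oC cC] Cx] CO]] : exists C, D C /\ C `<=` O.
    apply: contrapT => nC.
    pose f (C : {classic set T}) : set T := if `[< D C >] then C `\` O else setT.
    have fE C : D C -> f C = C `\` O by move=> DC; rewrite /f asboolT.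
    have [|s|z zf] := @compact_finite_intersection T {classic set T} f cT.
    - move=> C; rewrite /f; case: asboolP => [[[_ cC] _]|_]; last exact: closedT.
      by apply: closedI => //; exact: open_closedC.
    - pose M := [set z | forall C : {classic set T}, C \in s -> D C -> (C : set T) z].
      have DM : D M.
        rewrite {}/M; elim: s => [|E s [[oM cM] Mx]].
          by rewrite (_ : [set z | _] = setT) //; [split=> //; exact: clopenT|apply/seteqP].
        have -> : [set z | forall C, C \in E :: s -> D C -> (C : set T) z] =
           (if `[< D E >] then E : set T else setT) `&`
           [set z | forall C : {classic set T}, C \in s -> D C -> (C : set T) z].
          apply/seteqP; split=> [z zE|z [zE zs] C].
            split=> [|C Cs]; last by apply: zE; rewrite inE Cs orbT.
            by case: asboolP => // DE; apply: zE => //; exact: mem_head.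
          rewrite inE => /orP[/eqP->|Cs]; last exact: zs.
          by move: zE; case: asboolP.
        case: asboolP => [[cE Ex]|_]; last by rewrite setTI; split.
        by split; [exact: clopenI|split].
      have : ~ (M `<=` O) by move=> MO; apply: nC; exists M.
      move=> /existsNP[z /not_implyP[Mz Oz]]; exists z => C Cs.
      by rewrite /f; case: asboolP => // DC; split=> //; exact: Mz.
    - have Qz : Q z by move=> C DC; have := zf C; rewrite fE // => -[].
      have := zf setT; rewrite fE; last by split=> //; exact: clopenT.
      by move=> [_]; apply; exact: QO.
  have DCU : D (C `&` U).
    split; last by split=> //; exact: AU.
    split; first exact: openI.
    have -> : C `&` U = C `&` closure V.
      apply/seteqP; split=> z [Cz]; first by move=> /UV/subset_closure.
      by move=> Vz; split=> //; have [] := CO z Cz.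
    by apply: closedI => //; exact: closed_closure.
  rewrite -subset0 => z Bz.
  have Qz : Q z by rewrite QAB; right.
  have [_ /UV/subset_closure/cV/(_ Bz)] := Qz _ DCU; exact.
apply: contrapT => /connectedPn[E [E0 QE [sE1 sE2]]].
have cE b : closed (E b).
  have QEb : Q = E b `|` E (~~ b) by case: b => //=; rewrite setUC.
  have : closure (E b) `<=` E b; last by [].
  move=> z Ez; have : Q z.
    by apply: clQ; apply: (closureS _ Ez); rewrite QEb; exact: subsetUl.
  rewrite QEb => -[//|Enz]; exfalso.
  case: b Ez Enz {QEb} => /= Ez Enz.
    by have : (E false `&` closure (E true)) z by []; rewrite sE2.
  by have : (closure (E false) `&` E true) z by []; rewrite sE1.
have E12 : E false `&` E true = set0.
  rewrite -subset0 => z [z1 z2]; rewrite -[X in X z]sE1; split=> //.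
  exact: subset_closure.
move: Qx; rewrite QE => -[] Ex.
  by have [z] := E0 true; rewrite (split_absurd _ _ (cE false) (cE true)).
have [z] := E0 false.
by rewrite (split_absurd _ _ (cE true) (cE false)) // 1?setUC // setIC.
Qed.

Lemma prod_hausdorff (S T : topologicalType) :
  hausdorff_space S -> hausdorff_space T -> hausdorff_space (S * T)%type.
Proof.
move=> hS hT; rewrite open_hausdorff => -[a b] [c d] ne.
have oh := @open_hausdorff.
have [ac|ac] := eqVneq a c; last first.
  move: hS; rewrite oh => /(_ _ _ ac)[[A C] [/= aA cC] [oA oC AC]].
  exists (fst @^-1` A, fst @^-1` C) => /=.
    by split; rewrite inE /=; apply: set_mem.
  split; try by apply: (continuousP _).1 => // x; exact: cvg_fst.
  apply/eqP; rewrite -subset0 => z [Az Bz].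
  by move/eqP: AC => /seteqP[+ _] => /(_ z.1); apply.
have bd : b != d by apply: contra_neq ne => ->; rewrite ac.
move: hT; rewrite oh => /(_ _ _ bd)[[A C] [/= aA cC] [oA oC AC]].
exists (snd @^-1` A, snd @^-1` C) => /=.
  by split; rewrite inE /=; apply: set_mem.
split; try by apply: (continuousP _).1 => // x; exact: cvg_snd.
apply/eqP; rewrite -subset0 => z [Az Bz].
by move/eqP: AC => /seteqP[+ _] => /(_ z.2); apply.
Qed.

(** * Profinite groups and their quotients *)

Section MorphismOf.
Variables (H E : topGroupType) (f : H -> E) (fM : {morph f : x y / x * y}).

Lemma morphism_of1 : f 1 = 1.
Proof. by apply: (mulgI (f 1)); rewrite -fM !mulg1. Qed.

Definition morphism_of : UMagmaMorphism.type H E :=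
  HB.pack f (isMultiplicative.Build H E f fM)
    (Multiplicative_isUMagmaMorphism.Build H E f morphism_of1).

End MorphismOf.

Section NormalSubgroups.
Variable H : topGroupType.
Implicit Types (M N : normalSubgroup H).

Lemma normalSubgroup_eq M N : (M : set H) = N -> M = N.
Proof.
case: M N => [M M1 MM MV MJ Mc] [N N1 NM NV NJ Nc] /= MN.
by subst N; congr NormalSubgroup; exact: Prop_irrelevance.
Qed.

Definition nsub_trivial (hH : hausdorff_space H) : normalSubgroup H.
Proof.
apply: (@NormalSubgroup H [set 1]) => //= [x y -> ->|x ->|x y ->|].
- exact: mulg1.
- exact: invg1.
- exact: conj1g.
- exact/accessible_closed_set1/hausdorff_accessible.
Defined.

Definition nsubI M N : normalSubgroup H.
Proof.
apply: (@NormalSubgroup H (nsub M `&` nsub N)).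
- by split; exact: nsub1.
- by move=> x y [Mx Nx] [My Ny]; split; exact: nsubM.
- by move=> x [Mx Nx]; split; exact: nsubV.
- by move=> x y [Mx Nx]; split; exact: nsubJ.
- by apply: closedI; exact: nsub_closed.
Defined.

Definition nsub_mul (cH : compact [set: H]) (hH : hausdorff_space H) M N :
  normalSubgroup H.
Proof.
apply: (@NormalSubgroup H [set z | exists m n, [/\ nsub M m, nsub N n & z = m * n]]).
- by exists 1, 1; split; [exact: nsub1|exact: nsub1|rewrite mulg1].
- move=> _ _ [m [n [Mm Nn ->]]] [m' [n' [Mm' Nn' ->]]].
  exists (m * m'), (n ^ m' * n'); split.
  + exact: nsubM.
  + by apply: nsubM => //; exact: nsubJ.
  + by rewrite conjgE !mulgA mulgK.
- move=> _ [m [n [Mm Nn ->]]]; exists m^-1, (n^-1 ^ m^-1); split.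
  + exact: nsubV.
  + by apply/nsubJ/nsubV.
  + by rewrite conjgE invgK invgM !mulgA mulVg mul1g.
- move=> _ y [m [n [Mm Nn ->]]]; exists (m ^ y), (n ^ y).
  by split; rewrite ?conjMg //; exact: nsubJ.
- have -> : [set z | exists m n, [/\ nsub M m, nsub N n & z = m * n]] =
      (fun x : H * H => x.1 * x.2) @` (nsub M `*` nsub N).
    apply/seteqP; split=> [_ [m [n [Mm Nn ->]]]|_ [[m n] [Mm Nn] <-]].
      by exists (m, n).
    by exists m, n.
  apply: compact_closed => //; apply: compact_image; first exact: mulg_continuous.
  by apply: compact_setX; apply: subclosed_compact cH _ => //; exact: nsub_closed.
Defined.

End NormalSubgroups.

Section NormalTransport.
Variables (H E : topGroupType) (f : UMagmaMorphism.type H E).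
Hypothesis cf : continuous f.

Definition nsub_preim (N : normalSubgroup E) : normalSubgroup H.
Proof.
apply: (@NormalSubgroup H (f @^-1` nsub N)) => /=.
- by rewrite gmulf1; exact: nsub1.
- by move=> x y Nx Ny; rewrite gmulfM; exact: nsubM.
- by move=> x Nx; rewrite gmulfV; exact: nsubV.
- by move=> x y Nx; rewrite gmulfJ; exact: nsubJ.
- by apply: (continuous_closedP _).1 => //; exact: nsub_closed.
Defined.

Definition nsub_image (cH : compact [set: H]) (hE : hausdorff_space E)
  (sf : forall y, exists x, f x = y) (N : normalSubgroup H) : normalSubgroup E.
Proof.
apply: (@NormalSubgroup E (f @` nsub N)).
- by exists 1; rewrite ?gmulf1 //; exact: nsub1.
- move=> _ _ [x Nx <-] [y Ny <-]; exists (x * y); rewrite ?gmulfM //.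
  exact: nsubM.
- by move=> _ [x Nx <-]; exists x^-1; rewrite ?gmulfV //; exact: nsubV.
- move=> _ y [x Nx <-]; have [z <-] := sf y.
  by exists (x ^ z); rewrite ?gmulfJ //; exact: nsubJ.
- by apply: closed_image => //; exact: nsub_closed.
Defined.

End NormalTransport.

Definition nsub_ker (H G : topGroupType) (hG : hausdorff_space G) (p : epi H G) :
  normalSubgroup H := nsub_preim (@epi_continuous _ _ p) (nsub_trivial hG).

Section Translations.
Variable H : topGroupType.

Lemma mull_continuous (a : H) : continuous (fun x => a * x).
Proof.
by apply: (@continuous_mulg H H (fun=> a) id) => y; [exact: cvg_cst|exact: cvg_id].
Qed.

Lemma nbhs_translate (x : H) (A : set H) :
  nbhs x A <-> nbhs (1 : H) [set y | A (x * y)].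
Proof.
split=> nA.
  by apply: (@mull_continuous x 1 A); rewrite mulg1.
have h : nbhs x ((fun y => x^-1 * y) @^-1` [set y | A (x * y)]).
  by apply: (@mull_continuous x^-1 x); rewrite mulVg.
by apply: filterS h => y /=; rewrite mulVKg.
Qed.

Lemma open_subgroup (U : set H) : (forall x y, U x -> U y -> U (x * y)) ->
  nbhs (1 : H) U -> open U.
Proof.
move=> UM nU; rewrite openE => x Ux; apply/nbhs_translate.
by apply: filterS nU => y Uy; exact: UM.
Qed.

Lemma open_subgroup_closed (U : set H) : (forall x y, U x -> U y -> U (x * y)) ->
  (forall x, U x -> U x^-1) -> nbhs (1 : H) U -> closed U.
Proof.
move=> UM UV nU x clx.
have [|y [Uy /= Uxy]] := clx [set y | U (x^-1 * y)].
  apply/nbhs_translate; apply: filterS nU => y Uy /=.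
  by rewrite mulKg.
by rewrite -[x]invgK -[x^-1](mulgK y); apply/UV/UM/UV.
Qed.

End Translations.

(** For a clopen neighbourhood [C] of [1], the elements that can be inserted
    anywhere in a product without changing whether the product lies in [C] form
    a normal subgroup.  It is open because the condition, which ranges over the
    compact space [H * H], is open at each point. *)
Lemma open_normal_basis (H : profiniteGroupType) (W : set H) :
  nbhs (1 : H) W ->
  exists U : normalSubgroup H, open (nsub U) /\ nsub U `<=` W.
Proof.
move=> nW; have cH := @profinite_compact H; have hH := @profinite_hausdorff H.
have zH := totally_disconnected_zero_dimensional cH hH
  (@profinite_totally_disconnected H).
have [C [C1 [oC cC]] CW] := @zero_dimensional_cvg H 1 hH zH cH _ nW.
pose U := [set x | forall ab : H * H, C (ab.1 * x * ab.2) <-> C (ab.1 * ab.2)].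
have U1 : U 1 by move=> ab; rewrite mulg1.
have UM x y : U x -> U y -> U (x * y).
  move=> Ux Uy [a b] /=; rewrite mulgA.
  by have /= -> := Uy (a * x, b); rewrite -(Ux (a, b)).
have UV x : U x -> U x^-1.
  move=> Ux [a b] /=; have /= <- := Ux (a * x^-1, b).
  by rewrite mulgVK.
have UJ x y : U x -> U (x ^ y).
  move=> Ux [a b] /=; rewrite conjgE !mulgA.
  by have /= := Ux (a * y^-1, y * b); rewrite !mulgA mulgVK.
have nU : nbhs (1 : H) U.
  have cHH : compact [set: H * H].
    by rewrite -setXTT; exact: compact_setX.
  have /(compact_near_coveringP _).1 ncH := cHH.
  suff h : \forall x \near (1 : H), [set: H * H] `<=`
      [set ab | C (ab.1 * x * ab.2) <-> C (ab.1 * ab.2)].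
    by apply: filterS h => x Hx ab; exact: Hx.
  apply: ncH => -[a b] _.
  pose f (z : (H * H) * H) := z.1.1 * z.2 * z.1.2.
  pose g (z : (H * H) * H) := z.1.1 * z.1.2.
  have c11 : continuous (fun z : (H * H) * H => z.1.1).
    by move=> z; apply: (@continuous_comp _ _ _ fst fst); exact: cvg_fst.
  have c12 : continuous (fun z : (H * H) * H => z.1.2).
    move=> z; apply: (@continuous_comp _ _ _ fst snd); [exact: cvg_fst|exact: cvg_snd].
  have cf : continuous f.
    apply: continuous_mulg => //; apply: continuous_mulg => // z; exact: cvg_snd.
  have cg : continuous g by exact: continuous_mulg.
  have key (D : set H) : open D -> D (a * b) ->
      \forall z \near ((a, b), 1 : H), D (f z) /\ D (g z).
    move=> oD Dab; apply: filterI.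
      by apply: (cf ((a, b), 1)); apply: open_nbhs_nbhs; split=> //; rewrite /f /= mulg1.
    by apply: (cg ((a, b), 1)); apply: open_nbhs_nbhs; split.
  have [Cab|Cab] := pselect (C (a * b)).
    by have := key C oC Cab; apply: filterS => -[[a' b'] x] /= [].
  have := key (~` C) (closed_openC cC) Cab.
  by apply: filterS => -[[a' b'] x] /= [].
exists (NormalSubgroup U1 UM UV UJ (open_subgroup_closed UM UV nU)).
split; first exact: open_subgroup.
by move=> x /= /(_ (1, 1)); rewrite /= !mul1g mulg1 => xC; apply/CW/xC.
Qed.

Section QuotientProfinite.
Variables (H : profiniteGroupType) (N : normalSubgroup H).
Local Notation Q := (quotg N).

Lemma quotg_compact : compact [set: Q].
Proof.
have -> : [set: Q] = qproj N @` [set: H].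
  by apply/seteqP; split=> // x _; exists (repr x) => //; exact: qprojK.
by apply: compact_image; [exact: qproj_continuous|exact: profinite_compact].
Qed.

(** If [a] and [b] differ modulo [N], some open normal [U] has [a^-1 * b * U]
    disjoint from [N]; the image of [a * U] is then a coset of an open subgroup
    of the quotient, hence clopen, and does not contain the image of [b]. *)
Lemma quotg_zero_dimensional : zero_dimensional Q.
Proof.
move=> x y; rewrite -[x]qprojK -[y]qprojK; move: (repr x) (repr y) => {x y} a b ab.
have nNab : ~ nsub N (a^-1 * b).
  by move/qprojP => e; rewrite e eqxx in ab.
have [U [oU UN]] : exists U : normalSubgroup H,
    open (nsub U) /\ nsub U `<=` [set u | ~ nsub N (a^-1 * b * u)].
  apply: open_normal_basis; apply/(@nbhs_translate H (a^-1 * b) (~` nsub N)).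
  apply: open_nbhs_nbhs; split=> //; exact/closed_openC/nsub_closed.
have nU x : nbhs x [set y | nsub U (x^-1 * y)].
  apply/nbhs_translate; have : nbhs (1 : H) (nsub U).
    by apply: open_nbhs_nbhs; split=> //; exact: nsub1.
  by apply: filterS => u Uu /=; rewrite mulKg.
have ext c : ~ (qproj N @` [set y | nsub U (a^-1 * y)]) (qproj N c) ->
    forall u, nsub U (c^-1 * u) ->
    ~ (qproj N @` [set y | nsub U (a^-1 * y)]) (qproj N u).
  move=> nc u Ucu [v Uv vu]; apply: nc.
  exists (v * (u^-1 * c)) => /=.
    rewrite mulgA; apply: nsubM => //; rewrite -[u^-1 * c]invgK invgM invgK.
    exact: nsubV.
  by rewrite !qprojM vu qprojV mulVKg.
exists (qproj N @` [set y | nsub U (a^-1 * y)]); split.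
- split.
    apply: qproj_open; rewrite openE => y /= Uy.
    apply: filterS (nU y) => z /= Uz.
    by have := nsubM Uy Uz; rewrite mulgA mulgK.
  rewrite -openC; have -> : ~` (qproj N @` [set y | nsub U (a^-1 * y)]) =
      qproj N @` [set c | ~ (qproj N @` [set y | nsub U (a^-1 * y)]) (qproj N c)].
    apply/seteqP; split=> [z nz|_ [c nc <-]//].
    by exists (repr z); rewrite ?qprojK //= qprojK.
  apply: qproj_open; rewrite openE => c nc; apply: filterS (nU c) => u.
  exact: ext.
- by exists a => //=; rewrite mulVg; exact: nsub1.
- move=> [v Uv /qprojP Nv]; apply: (UN ((v^-1 * a) ^ (a^-1 * b))).
    apply: nsubJ; rewrite -[v^-1 * a]invgK invgM invgK; exact: nsubV.
  by rewrite conjgE mulVKg -(mulgA v^-1 a) mulVKg.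
Qed.

Lemma quotg_hausdorff : hausdorff_space Q.
Proof.
rewrite open_hausdorff => x y /quotg_zero_dimensional[U [[oU cU] Ux Uy]].
exists (U, ~` U) => /=; first by split; rewrite inE.
by split=> //; [exact: closed_openC|rewrite setICr].
Qed.

HB.instance Definition _ := isProfinite.Build (quotg N) quotg_compact
  quotg_hausdorff (zero_dimension_totally_disconnected quotg_zero_dimensional).

End QuotientProfinite.

(** * Homomorphisms over a group and fiber products *)

Section HomOver.
Variable G : topGroupType.

Record hom_over (H E : topGroupType) (q : epi H G) (eta : epi E G) := HomOver {
  hom_fun :> UMagmaMorphism.type H E;
  hom_continuous : continuous hom_fun;
  hom_base : forall x, eta (hom_fun x) = q x
}.

Definition hom_of (H E : topGroupType) (q : epi H G) (eta : epi E G) (f : H -> E)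
    (fM : {morph f : x y / x * y}) (cf : continuous f)
    (bf : forall x, eta (f x) = q x) : hom_over q eta :=
  @HomOver H E q eta (morphism_of fM) cf bf.

Definition comp_hom (H E F : topGroupType) (q : epi H G) (eta : epi E G)
    (theta : epi F G) (g : hom_over eta theta) (f : hom_over q eta) :
  hom_over q theta.
Proof.
apply: (@hom_of _ _ q theta (g \o f)) => [x y|x|x] /=.
- by rewrite !gmulfM.
- by apply: continuous_comp; exact: hom_continuous.
- by rewrite !hom_base.
Defined.

Lemma iso_over_hom (H E : topGroupType) (q : epi H G) (eta : epi E G) :
  iso_over q eta -> exists (f : hom_over q eta) (g : hom_over eta q),
    cancel f g /\ cancel g f.
Proof.
move=> [f [g [cf cg fK gK fq]]].
have gM : {morph g : x y / x * y} by exact: can2_gmulfM fK gK.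
exists (hom_of (@gmulfM _ _ f) cf (fun x => esym (fq x))).
have gq x : q (g x) = eta x by rewrite fq gK.
by exists (hom_of gM cg gq).
Qed.

Lemma hom_iso_over (H E : topGroupType) (q : epi H G) (eta : epi E G)
    (f : hom_over q eta) (g : hom_over eta q) :
  cancel f g -> cancel g f -> iso_over q eta.
Proof.
move=> fK gK; exists f, g; split=> // [||x]; rewrite ?hom_base //;
  exact: hom_continuous.
Qed.

Lemma iso_over_refl (H : topGroupType) (q : epi H G) : iso_over q q.
Proof. by exists idfun, idfun; split=> // x; exact: cvg_id. Qed.

Lemma iso_over_sym (H E : topGroupType) (q : epi H G) (eta : epi E G) :
  iso_over q eta -> iso_over eta q.
Proof. by move=> /iso_over_hom[f [g [fK gK]]]; exact: hom_iso_over gK fK. Qed.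

Lemma iso_over_trans (H E F : topGroupType) (q : epi H G) (eta : epi E G)
    (theta : epi F G) :
  iso_over q eta -> iso_over eta theta -> iso_over q theta.
Proof.
move=> /iso_over_hom[f [g [fK gK]]] /iso_over_hom[f' [g' [fK' gK']]].
apply: (@hom_iso_over _ _ _ _ (comp_hom f' f) (comp_hom g g')) => x /=.
  by rewrite fK' fK.
by rewrite gK gK'.
Qed.

Lemma hom_bij_iso_over (H E : topGroupType) (q : epi H G) (eta : epi E G)
    (f : hom_over q eta) : compact [set: H] -> hausdorff_space E ->
  injective f -> (forall y, exists x, f x = y) -> iso_over q eta.
Proof.
move=> cH hE fI fS; pose g y := projT1 (cid (fS y)).
have gK : cancel g f by move=> y; exact: (projT2 (cid (fS y))).
have fK : cancel f g by move=> x; apply: fI; rewrite gK.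
exists f, g; split=> // [||x]; last by rewrite hom_base.
  exact: hom_continuous.
by apply: (continuous_inverse cH hE _ fK gK); exact: hom_continuous.
Qed.

End HomOver.

Section QuotientHom.
Variables (H G : topGroupType) (p : epi H G) (N : normalSubgroup H).
Hypothesis NK : nsub N `<=` ker p.

Definition qproj_hom : hom_over p (quot_epi NK) :=
  @hom_of _ _ _ p (quot_epi NK) _ (@qprojM H N) (@qproj_continuous _ N)
    (quot_map_qproj NK).

Definition qproj_epi : epi H (quotg N).
Proof.
exists (morphism_of (@qprojM H N)); first exact: qproj_continuous.
by move=> y; exists (repr y); exact: qprojK.
Defined.

Section Factor.
Variables (E : topGroupType) (eta : epi E G) (f : hom_over p eta).
Hypothesis fN : forall x, nsub N x -> f x = 1.

Lemma factor_subproof x y : qproj N x = qproj N y -> f x = f y.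
Proof.
by move=> /qprojP/fN; rewrite gmulfM gmulfV => e; rewrite -[RHS](mulVKg (f x)) e mulg1.
Qed.

Lemma factor_qproj x : f (repr (qproj N x)) = f x.
Proof. by apply: factor_subproof; rewrite qprojK. Qed.

Definition factor_hom : hom_over (quot_epi NK) eta.
Proof.
apply: (@hom_of _ _ _ _ _ (fun x : quotg N => f (repr x))) => [x y||x].
- by rewrite -gmulfM -[RHS]factor_qproj qprojM !qprojK.
- apply/quotient_continuous.
  have -> : (fun x : quotg N => f (repr x)) \o \pi_(quotg N)%qT = f.
    by apply/funext => x; exact: factor_qproj.
  exact: hom_continuous.
- by rewrite hom_base.
Defined.

Lemma factor_homE x : factor_hom (qproj N x) = f x.
Proof. exact: factor_qproj. Qed.

End Factor.

End QuotientHom.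

Section FiberProducts.
Variables (H G : topGroupType) (q : epi H G) (I : Type).
Variables (E : I -> topGroupType) (eta : forall i, epi (E i) G).

Definition fibprod_proj (i : I) : hom_over (fibprod_epi eta) (eta i).
Proof.
apply: (@hom_of _ _ _ _ _ (fun x : fibprod eta => fibprod_coord x i)) => //.
  exact: fibprod_coord_continuous.
by move=> x; rewrite fibprodP.
Defined.

Variable f : forall i, hom_over q (eta i).

Definition fibprod_pair : hom_over q (fibprod_epi eta).
Proof.
apply: (@hom_of _ _ _ _ _
  (fun x => mk_fibprod (fun i => hom_base (f i) x) : fibprod eta)) => //.
- by move=> x y; apply: fibprod_eq => [|i]; exact: gmulfM.
- by apply: fibprod_continuous => [|i]; [exact: epi_continuous|exact: hom_continuous].
Defined.

Lemma fibprod_hausdorff : hausdorff_space G ->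
  (forall i, hausdorff_space (E i)) -> hausdorff_space (fibprod eta).
Proof.
move=> hG hE.
apply: (@hausdorff_inj _ _ (val : fibprod eta ->
    G * prod_topology (fun i => E i : topologicalType))).
- apply: prod_hausdorff => //.
  exact: (@hausdorff_product {classic I} (fun i => E i : topologicalType)).
- exact: initial_continuous.
- exact: val_inj.
Qed.

Hypothesis cH : compact [set: H].
Hypothesis hG : hausdorff_space G.
Hypothesis hE : forall i, hausdorff_space (E i).
Hypothesis f_inj : forall x, ker q x -> (forall i, f i x = 1) -> x = 1.

Lemma fibprod_iso :
  (forall g (y : forall i, E i), (forall i, eta i (y i) = g) ->
     exists x, q x = g /\ forall i, f i x = y i) ->
  iso_over q (fibprod_epi eta).
Proof.
move=> fS; apply: (hom_bij_iso_over (f := fibprod_pair)) => //.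
- exact: fibprod_hausdorff.
- apply: gmulf_inj => x x1; apply: f_inj => [|i].
    by rewrite /ker /= -(hom_base fibprod_pair) x1 gmulf1.
  by rewrite -[LHS]/(fibprod_coord (fibprod_pair x) i) x1.
- move=> y; have [x [xg xy]] := fS (fibprod_base y) (fibprod_coord y) (fibprodP y).
  by exists x; apply: fibprod_eq.
Qed.

(** A compatible family is hit as soon as all its finite subfamilies are hit,
    by compactness, and this may be checked on the kernels. *)
Lemma fibprod_lift_finite :
  (forall (s : seq {classic I}) (y : forall i, E i), (forall i, ker (eta i) (y i)) ->
     exists x, ker q x /\ forall i : {classic I}, i \in s -> f i x = y i) ->
  forall g (y : forall i, E i), (forall i, eta i (y i) = g) ->
  exists x, q x = g /\ forall i, f i x = y i.
Proof.
move=> fS g y yg.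
have [h hg] := epi_surj q g.
have [|s|x xC] := @compact_finite_intersection H (option {classic I})
   (fun o => if o is Some i then f i @^-1` [set y i] else q @^-1` [set g]) cH.
- case=> [i|]; apply: (continuous_closedP _).1.
  + exact: hom_continuous.
  + exact/accessible_closed_set1/hausdorff_accessible.
  + exact: epi_continuous.
  + exact/accessible_closed_set1/hausdorff_accessible.
- have [|x [qx xy]] := fS (pmap id s) (fun i => (f i h)^-1 * y i).
    by move=> i; rewrite /ker /= gmulfM gmulfV hom_base hg yg mulVg.
  exists (h * x) => -[i|] si /=; last by rewrite gmulfM hg qx mulg1.
  rewrite gmulfM xy ?mulVKg //.
  by rewrite mem_pmap map_id.
- by exists x; split=> [|i]; [exact: (xC None)|exact: (xC (Some i))].
Qed.

End FiberProducts.

(** * Minimal kernels and maximal normal subgroups *)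

Lemma qproj_eq1 (H : topGroupType) (N : normalSubgroup H) x :
  qproj N x = 1 <-> nsub N x.
Proof.
rewrite -[1]/(qproj N 1); split=> [/esym/qprojP|Nx].
  by rewrite invg1 mul1g.
by apply/esym/qprojP; rewrite invg1 mul1g.
Qed.

Lemma is_iso_inj (H G : topGroupType) (p : epi H G) : is_iso p -> injective p.
Proof. by move=> [p' [_ pK _]]; exact: can_inj pK. Qed.

Lemma inj_is_iso (H G : profiniteGroupType) (p : epi H G) :
  injective p -> is_iso p.
Proof.
move=> pI.
have pK : cancel p (Defs.lift p) by move=> x; apply: pI; exact: Defs.liftK.
exists (Defs.lift p); split=> //; last exact: Defs.liftK.
apply: (continuous_inverse (@profinite_compact H) (@profinite_hausdorff G) _ pK).
  exact: epi_continuous.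
exact: Defs.liftK.
Qed.

(** This is indecomposability, seen on the kernel alone: a form that passes to
    quotients and makes sense before the domain is known to be profinite. *)
Definition minimal_kernel (H G : topGroupType) (p : epi H G) : Prop :=
  (exists2 x, ker p x & x <> 1) /\
  forall N : normalSubgroup H, nsub N `<=` ker p ->
    (N : set H) = [set 1] \/ (N : set H) = ker p.

Section MinimalKernel.
Variable G : profiniteGroupType.

Lemma kernel_inj (H E : topGroupType) (p : epi H E) : ker p = [set 1] -> injective p.
Proof. by move=> p1; apply: gmulf_inj => x px; have : ker p x by []; rewrite p1. Qed.

(** The kernel of the first factor of a decomposition is trivial or everything,
    and then the first or the second factor is injective. *)
Lemma minimal_kernel_indecomposable (H : profiniteGroupType) (p : epi H G) :
  minimal_kernel p -> indecomposable p.
Proof.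
move=> [[x px x1] pmin]; split=> [/is_iso_inj pI|K a b pab].
  by apply: x1; apply: pI; rewrite gmulf1.
have aE : nsub (nsub_ker (@profinite_hausdorff K) a) = ker a by [].
have [y|a1|ak] := pmin (nsub_ker (@profinite_hausdorff K) a).
- by rewrite aE /ker /= pab => ->; rewrite gmulf1.
- by left; apply/inj_is_iso/kernel_inj; rewrite -aE.
- right; apply/inj_is_iso/gmulf_inj => z; have [y <-] := epi_surj a z.
  move=> ay; have : ker p y by rewrite /ker /= pab.
  by rewrite -ak aE.
Qed.

(** A closed normal [N] inside the kernel decomposes [p] through [H / N]. *)
Lemma indecomposable_minimal_kernel (H : profiniteGroupType) (p : epi H G) :
  indecomposable p -> minimal_kernel p.
Proof.
move=> [niso pdec]; split.
  apply: contrapT => nx; apply/niso/inj_is_iso/gmulf_inj => x px.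
  by apply: contrapT => x1; apply: nx; exists x.
move=> N NK; have [|/is_iso_inj aI|/is_iso_inj bI] :=
    pdec (quotg N) (qproj_epi N) (quot_epi NK).
- by move=> x; rewrite /= quot_map_qproj.
- left; apply/seteqP; split=> [x Nx|_ ->]; last exact: nsub1.
  by apply: aI; rewrite gmulf1; exact/qproj_eq1.
- right; apply/seteqP; split=> [//|x px]; apply/qproj_eq1.
  by apply: bI; rewrite gmulf1 /= quot_map_qproj.
Qed.

Lemma minimal_kernel_iso (H E : topGroupType) (q : epi H G) (eta : epi E G) :
  iso_over q eta -> minimal_kernel q -> minimal_kernel eta.
Proof.
move=> /iso_over_hom[f [g [fK gK]]] [[x qx x1] qmin]; split.
  exists (f x); first by rewrite /ker /= hom_base.
  by move=> fx1; apply: x1; rewrite -[x]fK fx1 gmulf1.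
move=> N NK; have [y Ny||] := qmin (nsub_preim (@hom_continuous _ _ _ _ _ f) N).
- by rewrite /ker /= -(hom_base f y); exact: NK.
- move=> /seteqP[/= N1 _]; left; apply/seteqP; split=> [y Ny|_ ->]; last exact: nsub1.
  by rewrite /= -[y]gK (N1 (g y)) ?gmulf1 //= gK.
- move=> /seteqP[/= _ kN]; right; apply/seteqP; split=> // y ky.
  by rewrite -[y]gK; apply: kN; rewrite /ker /= hom_base.
Qed.

End MinimalKernel.

Section Maximal.
Variables (H G : profiniteGroupType) (p : epi H G).
Implicit Types (M N : normalSubgroup H).

Lemma maximal_sub N : maximal_normal (ker p) N -> nsub N `<=` ker p.
Proof. by move=> [[]]. Qed.

(** Normal subgroups of [H] between [N] and [Ker p] correspond to the normal
    subgroups of [H / N] inside the kernel of [H / N -> G]. *)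
Lemma maximal_minimal_kernel N (NK : nsub N `<=` ker p) :
  maximal_normal (ker p) N <-> minimal_kernel (quot_epi NK).
Proof.
split=> [[[_ /existsNP[x /not_implyP[kx Nx]]] Nmax]|[[x kx x1] Nmin]]; split.
- exists (qproj N x); first by rewrite /ker /= quot_map_qproj.
  by move/qproj_eq1.
- move=> M MK; pose N' := nsub_preim (@epi_continuous _ _ (qproj_epi N)) M.
  have N'K : nsub N' `<=` ker p.
    by move=> y /MK; rewrite /ker /= quot_map_qproj.
  have NN' : nsub N `<=` N'.
    by move=> y /qproj_eq1 Ny; rewrite /= Ny; exact: nsub1.
  have [kN'|kN'] := pselect (ker p `<=` N').
    right; apply/seteqP; split=> // y; rewrite -[y]qprojK /ker /= quot_map_qproj.
    by move=> /kN'.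
  left; have N'E : (N : set H) = N' by apply: Nmax.
  apply/seteqP; split=> [y|_ ->]; last exact: nsub1.
  rewrite -[y]qprojK => My; apply/qproj_eq1.
  by change ((N : set H) (repr y)); rewrite N'E.
- split=> // kN; apply: x1; rewrite -[x]qprojK; apply/qproj_eq1/kN.
  by move: kx; rewrite -{1}[x]qprojK /ker /= quot_map_qproj.
- move=> N' [N'K kN'] NN'; apply/seteqP; split=> //.
  pose M := nsub_image (@epi_continuous _ _ (qproj_epi N)) (@profinite_compact H)
    (@profinite_hausdorff (quotg N)) (@epi_surj _ _ (qproj_epi N)) N'.
  have [_ [y /N'K ky <-]|/seteqP[M1 _] y N'y|/seteqP[_ kM]] := Nmin M.
  + by rewrite /ker /= quot_map_qproj.
  + by apply/qproj_eq1; apply: M1; exists y.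
  + exfalso; apply: kN' => y ky.
    have [|z N'z /qprojP/NN' Nzy] := kM (qproj N y).
      by rewrite /ker /= quot_map_qproj.
    by rewrite -[y](mulVKg z); exact: nsubM.
Qed.

(** [M N] is closed, being compact, and strictly larger than [N]. *)
Lemma maximal_mul_cover N M : maximal_normal (ker p) N -> nsub M `<=` ker p ->
  ~ (nsub M `<=` N) ->
  forall x, ker p x -> exists m n, [/\ nsub M m, nsub N n & x = m * n].
Proof.
move=> [[NK kN] Nmax] MK MN x kx.
pose P := nsub_mul (@profinite_compact H) (@profinite_hausdorff H) M N.
have NP : nsub N `<=` P.
  by move=> y Ny; exists 1, y; split; [exact: nsub1| |rewrite mul1g].
have [kP|kP] := pselect (ker p `<=` P); first exact: kP.
exfalso; apply: MN => y My.
have -> : (N : set H) = P.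
  apply: Nmax => //; split=> // _ [m [n [Mm Nn ->]]].
  by rewrite /ker /= gmulfM (MK _ Mm) (NK _ Nn) mulg1.
by exists y, 1; split; [|exact: nsub1|rewrite mulg1].
Qed.

Definition abelian_mod N := forall x y, ker p x -> ker p y ->
  qproj N x * qproj N y = qproj N y * qproj N x.

Lemma abelian_modP N (NK : nsub N `<=` ker p) :
  abelian_mod N <-> abelian_ker (quot_epi NK).
Proof.
split=> [ab x y|ab x y kx ky].
  by rewrite -[x]qprojK -[y]qprojK /ker /= !quot_map_qproj; exact: ab.
by apply: ab; rewrite /ker /= quot_map_qproj.
Qed.

(** What forces two maximal subgroups to belong to the same component.  In the
    second case [M] maps onto [Ker p / N] and onto [Ker p / N'] with the same
    kernel, so that the two modules are isomorphic. *)
Definition linked N N' := (N : set H) = N' \/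
  [/\ abelian_mod N, abelian_mod N' & exists M : normalSubgroup H,
    [/\ nsub M `<=` ker p, ~ (nsub M `<=` N), ~ (nsub M `<=` N')
      & forall x, nsub M x -> nsub N x <-> nsub N' x]].

Definition nsub_cap (I : Type) (N : I -> normalSubgroup H) (C : normalSubgroup H)
  (s : seq I) : normalSubgroup H := foldr (fun i => nsubI (N i)) C s.

Lemma nsub_capP (I : eqType) (N : I -> normalSubgroup H) C s x :
  nsub (nsub_cap N C s) x <-> nsub C x /\ forall i, i \in s -> nsub (N i) x.
Proof.
elim: s => [|i s IH] /=; first by split=> [|[]].
split=> [[Nx /IH[Cx sx]]|[Cx sx]].
  by split=> // j; rewrite inE => /orP[/eqP->|/sx].
split; first by apply: sx; exact: mem_head.
by apply/IH; split=> // j js; apply: sx; rewrite inE js orbT.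
Qed.

(** Remove the members of [s] one by one, as long as the intersection of [C]
    with the remaining ones stays inside [N'].  For the first [i] whose removal
    destroys the inclusion, the remaining intersection [M] satisfies
    [Ker p = M N'], while [M :&: N i] lies in [N'].  If [N i] differs from [N'],
    then also [Ker p = (N i) N'], and as commutators of [M] with [N i] lie in
    [M :&: N i], the quotient by [N'] is abelian; [M] is the subgroup that links
    [N i] to [N']. *)
Lemma linked_of_cap_sub (I : eqType) (N : I -> normalSubgroup H) N' C s :
  (forall i, i \in s -> maximal_normal (ker p) (N i)) ->
  maximal_normal (ker p) N' -> nsub C `<=` ker p -> ~ (nsub C `<=` N') ->
  nsub (nsub_cap N C s) `<=` N' -> exists2 i, i \in s & linked (N i) N'.
Proof.
move=> + N'max CK CN'; elim: s => [_ //|i s IH] smax /= capN'.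
set M := nsub_cap N C s in capN' IH *.
have Ni : maximal_normal (ker p) (N i) by apply: smax; exact: mem_head.
have [MN'|MN'] := pselect (nsub M `<=` N').
  have [|//|j js ij] := IH; last by exists j; rewrite // inE js orbT.
  by move=> j js; apply: smax; rewrite inE js orbT.
exists i; first exact: mem_head.
have MK : nsub M `<=` ker p by move=> x /nsub_capP[/CK].
have [NN'|NN'] := pselect (nsub (N i) `<=` N').
  by left; case: Ni => _; apply=> //; case: N'max.
right; have MNi : ~ (nsub M `<=` N i).
  by move=> MNi; apply: MN' => x Mx; apply: capN'; split=> //; exact: MNi.
have MNN' x : nsub M x -> nsub (N i) x <-> nsub N' x.
  move=> Mx; split=> [Nx|N'x]; first by apply: capN'.
  (* Otherwise [(M :&: N') (N i) = Ker p], and writing an element of [M] in this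
     form shows that it lies in [N']. *)
  apply: contrapT => nNx; apply: MN' => m Mm.
  have [||a [n [[Ma N'a] Nn mE]]] := maximal_mul_cover (M := nsubI M N') Ni _ _ (MK _ Mm).
  - by move=> y [/MK].
  - by move=> /(_ x (conj Mx N'x)).
  - rewrite mE; apply: nsubM => //; apply: capN'; split=> //.
    by rewrite -[n](mulKg a) -mE; apply: nsubM => //; exact: nsubV.
have abN' : abelian_mod N'.
  move=> x y kx ky.
  have [a [n [Ma N'n ->]]] := maximal_mul_cover N'max MK MN' kx.
  have [b [n' [Nb N'n' ->]]] := maximal_mul_cover N'max (maximal_sub Ni) NN' ky.
  rewrite !(qprojM _ _ n) !(qprojM _ _ n') !((qproj_eq1 _ _).2 N'n, (qproj_eq1 _ _).2 N'n').
  rewrite !mulg1 -!qprojM; apply/esym/qprojP.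
  have -> : (b * a)^-1 * (a * b) = [~ a, b].
    by rewrite commgEl conjgE invgM !mulgA.
  apply: capN'; split.
    by rewrite commgEr; apply: nsubM => //; apply/nsubJ/nsubV.
  by rewrite commgEl; apply: nsubM; [exact: nsubV|exact: nsubJ].
split=> //; last by exists M.
move=> x y kx ky.
have [a [n [Ma N'n ->]]] := maximal_mul_cover Ni MK MNi kx.
have [b [n' [Mb N'n' ->]]] := maximal_mul_cover Ni MK MNi ky.
rewrite !(qprojM _ _ n) !(qprojM _ _ n') !((qproj_eq1 _ _).2 N'n, (qproj_eq1 _ _).2 N'n').
rewrite !mulg1 -!qprojM; apply/qprojP/MNN'.
  by apply: nsubM; [apply: nsubV|]; apply: nsubM.
by apply/qprojP; rewrite !qprojM; apply: abN'; exact: MK.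
Qed.

(** By compactness [C] and [D] may be replaced by finite lists [s] and [t].  The
    members of [t] are then added one by one.  If the intersection [Q] of the
    previous ones is not contained in the new member [N'], neither is the
    intersection of [Q] with the members of [s], since none of these is linked
    to [N']; so the decomposition of the element can be corrected modulo [N']. *)
Lemma unlinked_mul_cover (C D : set (normalSubgroup H)) :
  C `<=` maximal_normal (ker p) -> D `<=` maximal_normal (ker p) ->
  (forall N N', C N -> D N' -> ~ linked N N') ->
  forall x, ker p x -> exists y, [/\ ker p y, forall N, C N -> nsub N y
    & forall N, D N -> nsub N (y^-1 * x)].
Proof.
move=> Cmax Dmax CD x kx; have hG := @profinite_hausdorff G.
pose J : eqType := {classic normalSubgroup H}.
pose K := nsub_ker hG p.
have fin (s t : seq J) : (forall N : J, N \in s -> C N) ->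
    (forall N : J, N \in t -> D N) ->
    exists m n, [/\ nsub (@nsub_cap J id K s) m, nsub (@nsub_cap J id K t) n & x = m * n].
  move=> sC; elim: t => [_|N' t IH tD] /=.
    by exists 1, x; split=> //; [exact: nsub1|rewrite mul1g].
  have [|m [n [Mm Qn xE]]] := IH.
    by move=> N Nt; apply: tD; rewrite inE Nt orbT.
  set Q := nsub_cap _ _ t in Qn *; have QK : nsub Q `<=` ker p by move=> y /nsub_capP[].
  have N'max : maximal_normal (ker p) N' by apply/Dmax/tD/mem_head.
  have [QN'|QN'] := pselect (nsub Q `<=` N').
    by exists m, n; split=> //; split=> //; exact: QN'.
  have MQN' : ~ (nsub (@nsub_cap J id Q s) `<=` N').
    move=> /(linked_of_cap_sub _ N'max QK QN')[N /sC/Cmax//|N /sC CN].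
    by apply: CD => //; exact/tD/mem_head.
  have MQ y : nsub (@nsub_cap J id Q s) y -> nsub Q y by move=> /nsub_capP[].
  have [y /MQ/QK//|m' [n' [Mm' N'n' nE]]] := maximal_mul_cover N'max _ MQN' (QK _ Qn).
  exists (m * m'), n'; split; last by rewrite xE nE mulgA.
    apply: nsubM => //; apply/nsub_capP; split; first exact/QK/MQ.
    by move: Mm' => /nsub_capP[].
  split=> //; rewrite -[n'](mulKg m') -nE.
  by apply: nsubM => //; exact/nsubV/MQ.
pose f (o : option J) := if o is Some N then
   [set y | (C N -> nsub N y) /\ (D N -> nsub N (y^-1 * x))] else ker p.
have [|s|y yf] := @compact_finite_intersection H (option J) f (@profinite_compact H).
- have cV : continuous (fun y : H => y^-1 * x).
    by apply: continuous_mulg => y; [exact: invg_continuous|exact: cvg_cst].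
  case=> [N|]; last by change (closed (nsub K)); exact: nsub_closed.
  have imp (P : Prop) (A : set H) : closed A -> closed [set y | P -> A y].
    have [hP|nP] := pselect P => cA; last first.
      by rewrite (_ : mkset _ = setT); [exact: closedT|apply/seteqP; split=> // y _ /nP].
    by rewrite (_ : mkset _ = A) //; apply/seteqP; split=> y /=; [exact|].
  change (closed ([set y | C N -> nsub N y] `&` [set y | D N -> nsub N (y^-1 * x)])).
  apply: closedI; apply: imp; first exact: nsub_closed.
  by move/continuous_closedP: cV; apply; exact: nsub_closed.
- have [| |m [n [Mm Qn xE]]] := fin [seq N <- pmap id s | `[< C N >]]
                                    [seq N <- pmap id s | `[< D N >]].
  + by move=> N; rewrite mem_filter => /andP[/asboolP].
  + by move=> N; rewrite mem_filter => /andP[/asboolP].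
  move: Mm Qn => /nsub_capP[Km sm] /nsub_capP[Kn sn].
  have mem (N : J) : Some N \in s -> N \in pmap id s by rewrite mem_pmap map_id.
  exists m => -[N|] // /mem Ns; split=> [CN|DN].
    by apply: sm; rewrite mem_filter Ns andbT; apply/asboolP.
  by rewrite xE mulKg; apply: sn; rewrite mem_filter Ns andbT; apply/asboolP.
- exists y; split=> [|N CN|N DN]; first exact: (yf None).
    by have [+ _] := yf (Some N); apply.
  by have [_] := yf (Some N); apply.
Qed.

(** An approximation in the coordinates of [s] is corrected in one more
    coordinate by an element that is trivial in those of [s]. *)
Lemma finite_approximation (I : eqType) (N : I -> normalSubgroup H) :
  (forall i (s : seq I), i \notin s -> forall x, ker p x ->
     exists y, [/\ ker p y, forall j, j \in s -> nsub (N j) y & nsub (N i) (y^-1 * x)]) ->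
  forall (s : seq I) (x : I -> H), (forall i, ker p (x i)) ->
  exists y, ker p y /\ forall i, i \in s -> nsub (N i) (y^-1 * x i).
Proof.
move=> cover s x kx; elim: s => [|i s [y [ky sy]]].
  by exists 1; split=> //; rewrite /ker /= gmulf1.
have [si|si] := boolP (i \in s).
  by exists y; split=> // j; rewrite inE => /orP[/eqP->|]; exact: sy.
have [|z [kz sz iz]] := cover i s si (y^-1 * x i).
  by rewrite /ker /= gmulfM gmulfV ky (kx i) mulVg.
exists (y * z); split=> [|j]; first by rewrite /ker /= gmulfM ky kz mulg1.
rewrite invgM -mulgA inE => /orP[/eqP->//|sj].
by apply: nsubM; [apply/nsubV/sz|exact: sy].
Qed.

End Maximal.

Local Open Scope ring_scope.

(** * Modules and kernels of epimorphisms *)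

Lemma open_points_continuous (S T : topologicalType) (f : S -> T) :
  (forall x : S, open [set x]) -> continuous f.
Proof.
move=> oS x W nW; have nx : nbhs x [set x] by apply: open_nbhs_nbhs.
by apply: filterS nx => _ -> /=; exact: nbhs_singleton.
Qed.

Lemma open_points_hausdorff (T : topologicalType) :
  (forall x : T, open [set x]) -> hausdorff_space T.
Proof.
move=> oT x y /(_ [set x] [set y])[||z [-> //]]; exact: open_nbhs_nbhs.
Qed.

Lemma compact_finite_set (T : topologicalType) :
  compact [set: T] -> (forall x : T, open [set x]) -> finite_set [set: T].
Proof.
move=> cT oT; apply: contrapT => inf.
have [a|s|x /(_ x)] := @compact_finite_intersection T T (fun a => ~` [set a]) cT.
- exact/open_closedC/oT.
- apply: contrapT => ns; apply: inf; apply: (@sub_finite_set _ _ [set` s]).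
    move=> x _ /=; apply: contrapT => xs; apply: ns; exists x => i si xi.
    by apply: xs; rewrite xi.
  exact: finite_seq.
- by apply.
Qed.

Section GModules.
Variable G : topGroupType.
Implicit Types A B C : gmodType G.

Definition ghom_of B A (f : B -> A) (fD : {morph f : x y / x + y})
    (cf : continuous f) (fg : forall g x, f (act g x) = act g (f x)) : ghom B A :=
  Sub f (introT (asboolP _) (And3 fD cf fg)).

Lemma gmod_iso_refl A : gmod_iso A A.
Proof. by exists (id_ghom A), (id_ghom A). Qed.

Lemma gmod_iso_sym B A : gmod_iso B A -> gmod_iso A B.
Proof. by move=> [f [g [fK gK]]]; exists g, f. Qed.

Lemma gmod_iso_trans C B A : gmod_iso C B -> gmod_iso B A -> gmod_iso C A.
Proof.
move=> [f [g [fK gK]]] [f' [g' [fK' gK']]].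
exists (comp_ghom f' f), (comp_ghom g g'); split=> x.
  by rewrite /ghom_fun /= fK' fK.
by rewrite /ghom_fun /= gK gK'.
Qed.

Lemma ghom_inj B A (f : ghom B A) : (forall x, f x = 0 -> x = 0) -> injective f.
Proof.
move=> f0 x y fxy; apply/subr0_eq/f0.
by rewrite ghomD ghomN fxy subrr.
Qed.

Lemma bij_gmod_isom B A (f : ghom B A) : compact [set: B] -> hausdorff_space A ->
  (forall x, f x = 0 -> x = 0) -> (forall y, exists x, f x = y) -> gmod_isom f.
Proof.
move=> cB hA f0 fS; have fI := ghom_inj f0.
pose g y := projT1 (cid (fS y)).
have gK : cancel g f by move=> y; exact: (projT2 (cid (fS y))).
have fK : cancel f g by move=> x; apply: fI; rewrite gK.
have gD : {morph g : x y / x + y} by move=> x y; apply: fI; rewrite ghomD !gK.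
have gg h x : g (act h x) = act h (g x) by apply: fI; rewrite ghom_act !gK.
have cg : continuous g.
  by apply: (continuous_inverse cB hA _ fK gK); exact: ghom_continuous.
by exists (ghom_of gD cg gg).
Qed.

Lemma submod_image B A (f : ghom B A) (S : set B) : S 0 ->
  (forall a b, S a -> S b -> S (a - b)) -> (forall (g : G) a, S a -> S (act g a)) ->
  simple_gmod A -> f @` S = [set 0] \/ f @` S = setT.
Proof.
move=> S0 SB Sg [_ Asimple]; apply: Asimple.
- by exists 0 => //; exact: ghom0.
- move=> _ _ [a Sa <-] [b Sb <-]; exists (a - b); first exact: SB.
  by rewrite ghomD ghomN.
- by move=> g _ [a Sa <-]; exists (act g a); [exact: Sg|exact: ghom_act].
Qed.

End GModules.

Section KernelHom.
Variables (G H E : topGroupType) (q : epi H G) (eta : epi E G).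
Variables (ab : abelian_ker q) (ab' : abelian_ker eta) (f : hom_over q eta).

Lemma ker_hom_subproof (x : kerMod ab) : f (val x) \in ker eta.
Proof. by apply/mem_set; rewrite /ker /= hom_base kerModP. Qed.

Definition ker_hom : ghom (kerMod ab) (kerMod ab').
Proof.
apply: (@ghom_of G (kerMod ab) (kerMod ab')
  (fun x => Sub (f (val x)) (ker_hom_subproof x) : kerMod ab')) => [x y||g x].
- by apply/val_inj; rewrite /= gmulfM.
- have c : continuous ((f : H -> E) \o (val : kerMod ab -> H)).
    move=> x; apply: continuous_comp; first exact: val_kerMod_continuous.
    exact: hom_continuous.
  by apply: kerMod_continuous; exact: c.
- have [h <-] := epi_surj q g; apply/val_inj.
  have e1 : act (q h) x = kerMod_conj h x by exact: kerMod_actE.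
  have e2 (y : kerMod ab') : act (q h) y = kerMod_conj (f h) y.
    by rewrite -(hom_base f); exact: kerMod_actE.
  rewrite e2; change (f (val (act (q h) x)) = f h * f (val x) * (f h)^-1)%g.
  by rewrite e1 /= !gmulfM gmulfV.
Defined.

Lemma ker_homE x : val (ker_hom x) = f (val x).
Proof. by []. Qed.

End KernelHom.

Section ProfiniteKernel.
Variables (E G : profiniteGroupType) (p : epi E G) (ab : abelian_ker p).
Local Notation K := (kerMod ab).

Lemma kerMod_mem x (px : ker p x) : exists k : K, val k = x.
Proof. by exists (Sub x (mem_set px)). Qed.

Lemma kerMod_compact : compact [set: K].
Proof.
have cE : compact (ker p).
  have cl := @nsub_closed _ (nsub_ker (@profinite_hausdorff G) p).
  by apply: (subclosed_compact cl (@profinite_compact E)).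
move=> F FF _.
have [|x [/kerMod_mem[k <-] clx]] := cE (fmap (val : K -> E) F) (fmap_proper_filter _ FF).
  have FT : F [set: K] by exact: filterT.
  have sub : [set: K] `<=` val @^-1` ker p by move=> k _; exact: (kerModP k).
  exact: (filterS sub FT).
exists k; split=> // A B FA /= [W [[V oV <-] /= Vk WB]].
have [|_ [[k' Ak' <-] Vk']] := clx (val @` A) V _ (open_nbhs_nbhs (conj oV Vk)).
  have sub : A `<=` val @^-1` (val @` A) by move=> k' Ak'; exists k'.
  exact: (filterS sub FA).
by exists k'; split=> //; exact: WB.
Qed.

Lemma kerMod_hausdorff : hausdorff_space K.
Proof.
apply: (@hausdorff_inj _ _ (val : K -> E) (@profinite_hausdorff E)).
  exact: val_kerMod_continuous.
exact: val_inj.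
Qed.

(** The action is covered by conjugation in [E], along the surjection of the
    compact space [E * K] onto [G * K]. *)
Lemma kerMod_continuous_action : continuous_action K.
Proof.
have cEK : compact [set: E * K].
  by rewrite -setXTT; apply: compact_setX; [exact: profinite_compact|exact: kerMod_compact].
have hGK : hausdorff_space (G * K)%type.
  by apply: prod_hausdorff; [exact: profinite_hausdorff|exact: kerMod_hausdorff].
apply: (@continuous_factor _ _ _ (fun x : E * K => (p x.1, x.2)) _ cEK hGK).
- move=> x; have cp : {for x, continuous (fun x : E * K => p x.1)}.
    apply: (@continuous_comp _ _ _ fst (p : E -> G)); first exact: cvg_fst.
    exact: epi_continuous.
  have cs : {for x, continuous (snd : E * K -> K)} by exact: cvg_snd.
  by have := cvg_pair cp cs; apply; exact: nbhs_filter.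
- by move=> [g k]; have [x <-] := epi_surj p g; exists (x, k).
- have -> : (fun x : G * K => act x.1 x.2) \o (fun x : E * K => (p x.1, x.2)) =
      (fun x : E * K => kerMod_conj x.1 x.2).
    by apply/funext => -[x k]; exact: kerMod_actE.
  apply: kerMod_continuous.
  apply: (@continuous_mulg _ _ (fun x : E * K => x.1 * val x.2)%g
    (fun x : E * K => x.1^-1)%g).
    apply: (@continuous_mulg _ _ fst (fun x : E * K => val x.2)) => x.
      exact: cvg_fst.
    apply: (@continuous_comp _ _ _ snd (val : K -> E)); first exact: cvg_snd.
    exact: val_kerMod_continuous.
  by apply: continuous_invg => x; exact: cvg_fst.
Qed.

Section Discrete.
Variable U : normalSubgroup E.
Hypotheses (oU : open (nsub U)) (Up : forall x, nsub U x -> ker p x -> x = 1%g).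

Lemma kerMod_open_points (k : K) : open [set k].
Proof.
have -> : [set k] = (fun x : K => (val k)^-1 * val x)%g @^-1` nsub U.
  apply/seteqP; split=> [_ ->|x Ux] /=; first by rewrite mulVg; exact: nsub1.
  apply/val_inj/esym/(mulgI (val k)^-1%g); rewrite mulVg; apply/esym.
  by apply: Up => //; rewrite /ker /= gmulfM gmulfV !kerModP mulVg.
have c : continuous ((fun y : E => (val k)^-1 * y)%g \o (val : K -> E)).
  move=> x; apply: continuous_comp; first exact: val_kerMod_continuous.
  exact: mull_continuous.
by move/continuousP: c; apply.
Qed.

Lemma kerMod_finite : finite_set [set: K].
Proof. exact: compact_finite_set kerMod_compact kerMod_open_points. Qed.

End Discrete.

(** An open normal subgroup missing one nontrivial element of the kernel meets
    the kernel in a proper subgroup, hence trivially. *)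
Lemma minimal_kernel_open_complement : minimal_kernel p ->
  exists U : normalSubgroup E,
    open (nsub U) /\ forall x, nsub U x -> ker p x -> x = 1%g.
Proof.
move=> [[x px x1] pmin].
have [|U [oU Ux]] := @open_normal_basis E (~` [set x]).
  apply: open_nbhs_nbhs; split; last by move=> /= x1'; apply: x1.
  exact/closed_openC/accessible_closed_set1/hausdorff_accessible/profinite_hausdorff.
exists U; split=> // y Uy py.
have [|/seteqP[I1 _]|/seteqP[_ kI]] :=
  pmin (nsubI U (nsub_ker (@profinite_hausdorff G) p)).
- by move=> z [].
- exact: (I1 y).
- by have [Ux' _] := kI x px; case: (Ux x Ux').
Qed.

(** The kernel is discrete, so each submodule is a closed normal subgroup of
    [E] inside the kernel. *)
Lemma minimal_kernel_simple : minimal_kernel p -> finite_simple_gmod K.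
Proof.
move=> pmin; have [U [oU Up]] := minimal_kernel_open_complement pmin.
have oK := kerMod_open_points oU Up.
split; [exact: kerMod_finite oU Up|exact: oK|exact: kerMod_continuous_action|].
case: pmin => -[x px x1] pmin; split.
  have [k kx] := kerMod_mem px; exists k; apply/eqP => k0; apply: x1.
  by rewrite -kx k0.
move=> S S0 SB Sg.
have SN a : S a -> S (- a) by rewrite -sub0r; exact: SB.
pose NS := [set x | exists2 k, S k & val k = x].
have NS1 : NS 1%g by exists 0.
have NSM x1' y : NS x1' -> NS y -> NS (x1' * y)%g.
  move=> [k Sk <-] [l Sl <-]; exists (k + l) => //.
  by rewrite -[l]opprK; apply: SB => //; exact: SN.
have NSV y : NS y -> NS y^-1%g by move=> [k Sk <-]; exists (- k) => //; exact: SN.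
have NSJ y z : NS y -> NS (y ^ z)%g.
  move=> [k Sk <-]; exists (act (p z^-1%g) k); first exact: Sg.
  by rewrite [act _ _]kerMod_actE /= invgK conjgE mulgA.
have NSc : closed NS.
  have -> : NS = val @` S by [].
  apply: closed_image; [exact: kerMod_compact|exact: profinite_hausdorff
    |exact: val_kerMod_continuous|].
  rewrite -openC (_ : ~` S = \bigcup_(k in ~` S) [set k]); last first.
    by rewrite bigcup_imset1 image_id.
  by apply: bigcup_open.
have [_ [k _ <-]|/seteqP[NSs _]|/seteqP[_ kNS]] :=
    pmin (NormalSubgroup NS1 NSM NSV NSJ NSc).
- exact: kerModP.
- left; apply/seteqP; split=> [k Sk|_ ->//]; apply/val_inj.
  by apply: (NSs (val k)); exists k.
- right; apply/seteqP; split=> // k _.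
  by have [l Sl /val_inj <-] := kNS (val k) (kerModP k).
Qed.

Lemma simple_minimal_kernel (A : gmodType G) : gmod_iso K A -> simple_gmod A ->
  minimal_kernel p.
Proof.
move=> [f [g [fK gK]]] Asimple; have [[a a0] _] := Asimple; split.
  exists (val (g a)); first exact: kerModP.
  move=> ga1; move/eqP: a0; apply; rewrite -[a]gK.
  by rewrite (_ : g a = 0) ?ghom0 //; apply/val_inj.
move=> N NK; pose S := [set k : K | nsub N (val k)].
have [||g' k|SA|SA] := @submod_image G K A f S _ _ _ Asimple.
- exact: nsub1.
- by move=> k l Nk Nl; apply: nsubM => //; exact: nsubV.
- have [h <-] := epi_surj p g'.
  have -> : act (p h) k = kerMod_conj h k by exact: kerMod_actE.
  by move=> Nk; have := nsubJ h^-1%g Nk; rewrite conjgE invgK mulgA.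
- left; apply/seteqP; split=> [x Nx|_ ->]; last exact: nsub1.
  have [k kx] := kerMod_mem (NK x Nx).
  have : (f @` S) (f k) by exists k => //; rewrite /S /= kx.
  rewrite SA -kx /= => fk; rewrite -[k]fK fk ghom0 //.
- right; apply/seteqP; split=> // x px; have [k kx] := kerMod_mem px.
  have : (f @` S) (f k) by rewrite SA.
  by move=> [l Sl /(can_inj fK) lk]; rewrite -kx -lk.
Qed.

End ProfiniteKernel.

(** * Extension classes and continuous sections *)

Section H2Functoriality.
Variable G : topGroupType.
Implicit Types A B C : gmodType G.

Lemma H2_class A (c : H2 A) : exists z, c = class2 z.
Proof. by exists (repr c); rewrite /class2 reprK. Qed.

Lemma H2map_comp C B A (g : ghom B A) (f : ghom C B) c :
  H2map (comp_ghom g f) c = H2map g (H2map f c).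
Proof.
have [z ->] := H2_class c; rewrite !H2map_class; congr class2.
exact/val_inj.
Qed.

Lemma H2map_id A (f : ghom A A) c : (forall x, f x = x) -> H2map f c = c.
Proof.
move=> f1; have [z ->] := H2_class c; rewrite H2map_class; congr class2.
by apply/val_inj/funext => x; exact: f1.
Qed.

End H2Functoriality.

Section Sections.
Variables (E G : topGroupType) (p : epi E G) (ab : abelian_ker p).
Local Notation K := (kerMod ab).

Lemma act_section (u : G -> E) (up : cancel u p) g (x : K) :
  act g x = kerMod_conj (u g) x.
Proof. by rewrite -{1}(up g); exact: kerMod_actE. Qed.

(** The two cocycles differ by the coboundary of [g |-> u' g * (u g)^-1]. *)
Lemma section_cocycle_class (u u' : G -> E) (uc : continuous u) (up : cancel u p)
    (uc' : continuous u') (up' : cancel u' p) :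
  class2 (section_cocycle ab uc' up') = class2 (section_cocycle ab uc up).
Proof.
apply/class2P/asboolP.
have dk g : (u' g * (u g)^-1)%g \in ker p.
  by apply/mem_set; rewrite /ker /= gmulfM gmulfV up up' mulgV.
pose d g : K := Sub (u' g * (u g)^-1)%g (dk g).
exists d => [|s t].
  have cd : continuous (val \o d).
    by apply: continuous_mulg => //; exact: continuous_invg.
  exact: kerMod_continuous cd.
rewrite (act_section up).
change (section_defect ab up' (s, t) - section_defect ab up (s, t) =
  kerMod_conj (u s) (d t) - d (s * t)%g + d s).
have -> : section_defect ab up' (s, t) = d s + kerMod_conj (u s) (d t) +
    section_defect ab up (s, t) - d (s * t)%g.
  apply/val_inj; rewrite /= !invgM !invgK !mulgA.
  by rewrite !mulgVK.
have cancel_defect (V : zmodType) (a b c r : V) : a + b + r - c - r = b - c + a.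
  by rewrite (addrAC (a + b + r)) addrK (addrC a) addrAC.
exact: cancel_defect.
Qed.

Lemma ext_class_section (u : G -> E) (uc : continuous u) (up : cancel u p) :
  ext_class ab = class2 (section_cocycle ab uc up).
Proof.
rewrite /ext_class; have [u' [uc' [up' ->]]] := xgetPex 0 (ex_intro _ _
  (ex_intro _ u (ex_intro _ uc (ex_intro _ up erefl))) : [set c | exists (u : G -> E)
     (uc : continuous u) (up : cancel u p), c = class2 (section_cocycle ab uc up)] !=set0).
exact: section_cocycle_class.
Qed.

End Sections.

Section ClassHom.
Variables (G H E : topGroupType) (q : epi H G) (eta : epi E G).
Variables (ab : abelian_ker q) (ab' : abelian_ker eta).
Hypothesis q_section : exists u : G -> H, continuous u /\ cancel u q.

(** A section of [q] composed with [f] is a section of [eta]. *)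
Lemma H2map_ker_hom (f : hom_over q eta) :
  H2map (ker_hom ab ab' f) (ext_class ab) = ext_class ab'.
Proof.
have [u [uc up]] := q_section.
have fuc : continuous ((f : H -> E) \o u).
  by move=> x; apply: continuous_comp; [exact: uc|exact: hom_continuous].
have fup : cancel ((f : H -> E) \o u) eta by move=> x; rewrite /= hom_base up.
rewrite (ext_class_section ab uc up) (ext_class_section ab' fuc fup) H2map_class.
congr class2; apply/val_inj/funext => -[s t]; apply/val_inj.
by rewrite /= !gmulfM gmulfV.
Qed.

Hypothesis eta_section : exists v : G -> E, continuous v /\ cancel v eta.

(** Let [u] and [v] be sections of [q] and [eta] and let [phi] send the cocycle
    of [u] to the cocycle of [v] plus the coboundary of [c]; then
    [a * u g |-> phi a * c g * v g] is multiplicative. *)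
Lemma hom_of_class (phi : ghom (kerMod ab) (kerMod ab')) :
  H2map phi (ext_class ab) = ext_class ab' ->
  exists f : hom_over q eta, forall b, f (val b) = val (phi b).
Proof.
have [u [uc up]] := q_section; have [v [vc vp]] := eta_section.
rewrite (ext_class_section ab uc up) (ext_class_section ab' vc vp) H2map_class.
move=> /class2P/asboolP[c cc cE].
have kk x : (x * (u (q x))^-1)%g \in ker q.
  by apply/mem_set; rewrite /ker /= gmulfM gmulfV up mulgV.
(* [x = k x * u (q x)] *)
pose k x : kerMod ab := Sub (x * (u (q x))^-1)%g (kk x).
have kM x y : k (x * y)%g = k x + act (q x) (k y) + section_defect ab up (q x, q y).
  rewrite (act_section up); apply/val_inj; rewrite /= !mulgA gmulfM.
  by rewrite !mulgVK.
have kc : continuous k.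
  have : continuous (val \o k).
    apply: (@continuous_mulg _ _ id (fun x => (u (q x))^-1)%g) => [x|]; first exact: cvg_id.
    apply: (@continuous_invg _ _ (u \o q)) => x; apply: continuous_comp; last exact: uc.
    exact: epi_continuous.
  exact: kerMod_continuous.
pose f x := (val (phi (k x)) * val (c (q x)) * v (q x))%g.
have fM : {morph f : x y / x * y}%g.
  move=> x y; rewrite {1}/f kM gmulfM; set s := q x; set t := q y.
  have /eqP := cE s t; rewrite subr_eq => /eqP cE'.
  change (phi (section_defect ab up (s, t)) = act s (c t) - c (s * t)%g + c s +
    section_defect ab' vp (s, t)) in cE'.
  have e : phi (k x + act s (k y) + section_defect ab up (s, t)) + c (s * t)%g =
    phi (k x) + c s + act s (phi (k y) + c t) + section_defect ab' vp (s, t).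
    rewrite !ghomD ghom_act cE' actD.
    have regroup (V : zmodType) (a b m n o r : V) :
        a + b + (n - o + m + r) + o = a + m + (b + n) + r.
      have -> : n - o + m + r = m + n + r - o.
        by rewrite (addrAC n) (addrAC (n + m)) (addrC n).
      by rewrite -addrA subrK !addrA (addrAC a).
    exact: regroup.
  have := congr1 val e; rewrite (act_section vp) /= => ->.
  by rewrite /f !mulgA !mulgVK.
have cf : continuous f.
  apply: continuous_mulg; last first.
    by move=> x; apply: (@continuous_comp _ _ _ q v); [exact: epi_continuous|exact: vc].
  apply: continuous_mulg => x.
    apply: (@continuous_comp _ _ _ (phi \o k) val); last exact: val_kerMod_continuous.
    by apply: continuous_comp; [exact: kc|exact: ghom_continuous].
  apply: (@continuous_comp _ _ _ (c \o q) val); last exact: val_kerMod_continuous.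
  by apply: continuous_comp; [exact: epi_continuous|exact: cc].
have bf x : eta (f x) = q x.
  by rewrite !gmulfM !kerModP vp !mul1g.
exists (hom_of fM cf bf) => b; rewrite -[LHS]/(f (val b)).
have f1 : f 1%g = 1%g by exact: morphism_of1 fM.
have kb : k (val b) = b + k 1%g.
  by apply/val_inj; rewrite /= mul1g kerModP gmulf1.
move: f1; rewrite /f kb ghomD /= kerModP gmulf1 -!mulgA => ->.
by rewrite mulg1.
Qed.

End ClassHom.

Section LocalSections.
Variables (E G : profiniteGroupType) (p : epi E G).

(** By compactness [G] has the quotient topology of [E / Ker p]. *)
Lemma epi_open (W : set E) : open W -> open (p @` W).
Proof.
move=> oW; pose N := nsub_ker (@profinite_hausdorff G) p.
pose r g := qproj N (Defs.lift p g).
have NK : nsub N `<=` ker p by [].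
have rK : cancel (quot_epi NK) r.
  move=> y; rewrite -[y]qprojK /= quot_map_qproj; apply/qprojP.
  by rewrite /= gmulfM gmulfV Defs.liftK mulVg.
have Kr : cancel r (quot_epi NK) by move=> g; rewrite /= quot_map_qproj Defs.liftK.
have rc : continuous r.
  apply: (continuous_inverse _ _ _ rK Kr); last exact: epi_continuous.
    exact: quotg_compact.
  exact: profinite_hausdorff.
have -> : p @` W = r @^-1` (qproj N @` W).
  apply/seteqP; split=> [_ [w Ww <-]|g [w Ww wg]].
    by exists w => //; rewrite -(rK (qproj N w)) /= quot_map_qproj.
  by exists w => //; rewrite -(Kr g) -wg /= quot_map_qproj.
by move/continuousP: rc; apply; exact: qproj_open.
Qed.

(** Modulo [p @` U] the group [G] is finite and a set-theoretic lift [e] is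
    locally constant; the section sends [g] to the unique point of [e g * U]
    above [g]. *)
Lemma local_section (U : normalSubgroup E) : open (nsub U) ->
  (forall x, nsub U x -> ker p x -> x = 1%g) ->
  exists u : G -> E, continuous u /\ cancel u p.
Proof.
move=> oU Up.
pose V := nsub_image (@epi_continuous _ _ p) (@profinite_compact E)
  (@profinite_hausdorff G) (@epi_surj _ _ p) U.
pose e g := Defs.lift p (repr (qproj V g)).
have ex g : exists x, p x = g /\ nsub U ((e g)^-1 * x)%g.
  have [w Uw wE] : nsub V ((p (e g))^-1 * g)%g.
    by rewrite Defs.liftK; apply/qprojP; rewrite qprojK.
  by exists (e g * w)%g; rewrite gmulfM wE mulVKg mulKg.
have [u /all_and2[up uU]] := choice ex.
exists u; split=> // g W nW.
have uniq x : nsub U ((e g)^-1 * x)%g -> u (p x) = x.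
  move=> Ux; have eE : e (p x) = e g.
    rewrite /e; congr (Defs.lift p (repr _)); rewrite -[RHS]qprojK.
    apply/esym/qprojP; rewrite -(Defs.liftK p (repr _)) -gmulfV -gmulfM.
    by exists ((e g)^-1 * x)%g.
  apply/(mulgI x^-1%g); rewrite mulVg; apply: Up; last first.
    by rewrite /ker /= gmulfM gmulfV up mulVg.
  rewrite (_ : x^-1 * _ = ((e g)^-1 * x)^-1 * ((e (p x))^-1 * u (p x)))%g.
    by apply: nsubM; [exact: nsubV|exact: uU].
  by rewrite eE invgM invgK !mulgA mulgK.
move: nW; rewrite {1}nbhsE => -[W' [oW' W'u] W'W].
have oS : open (W' `&` [set x | nsub U ((e g)^-1 * x)%g]).
  apply: openI => //.
  by have /continuousP := @mull_continuous E (e g)^-1%g; apply.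
have : nbhs g (p @` (W' `&` [set x | nsub U ((e g)^-1 * x)%g])).
  apply: open_nbhs_nbhs; split; first exact: epi_open.
  by exists (u g) => //; split=> //=; exact: uU.
apply: filterS => _ [x [W'x Ux] <-] /=; rewrite uniq //; exact: W'W.
Qed.

End LocalSections.

(** * Linear algebra over the endomorphisms of a simple module *)

Section Span.
Variables (G : topGroupType) (B A : gmodType G).
Hypotheses (oA : forall a : A, open [set a]) (Asimple : simple_gmod A).

Lemma sum_ghomE (I : Type) (s : seq I) (P : pred I) (F : I -> ghom B A) b :
  (\sum_(i <- s | P i) F i : ghom B A) b = \sum_(i <- s | P i) F i b.
Proof. exact: (big_morph (fun f : ghom B A => f b)). Qed.

Lemma sub_ghomE (f g : ghom B A) b : (f - g : ghom B A) b = f b - g b.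
Proof. by []. Qed.

Lemma scale_ghomE (c : gend A) (f : ghom B A) b :
  (c *: f : ghom B A) b = (c : ghom A A) (f b).
Proof. by []. Qed.

Section CommonKernel.
Variables (I : eqType) (phi : I -> ghom B A).

Definition common_kernel (s : seq I) : set B :=
  [set b | forall i, i \in s -> phi i b = 0].

Lemma common_kernelB s a b :
  common_kernel s a -> common_kernel s b -> common_kernel s (a - b).
Proof. by move=> sa sb i si; rewrite ghomD ghomN sa ?sb ?subrr. Qed.

Lemma common_kernel_image s (f : ghom B A) :
  f @` common_kernel s = [set 0] \/ f @` common_kernel s = setT.
Proof.
apply: submod_image => //.
- by move=> i _; exact: ghom0.
- exact: common_kernelB.
- by move=> g b sb i si; rewrite ghom_act sb ?act0.
Qed.

(** Schur's lemma, by induction on [s].  On the common kernel [W] of the members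
    of [s] the homomorphism [phi j] is zero or onto; in the second case [f]
    restricted to [W] factors as [psi] composed with [phi j], because it kills
    the kernel of [phi j] in [W], and the induction hypothesis applies to
    [f - psi *: phi j]. *)
Lemma common_kernel_span (s : seq I) : uniq s -> forall f : ghom B A,
  (forall b, common_kernel s b -> f b = 0) ->
  exists c : I -> gend A, f = \sum_(i <- s) c i *: phi i.
Proof.
elim: s => [_ f f0|j s IH /= /andP[js us] f f0].
  by exists (fun=> 0); rewrite big_nil; apply: ghomE => b; exact: f0.
have sj b : common_kernel s b -> phi j b = 0 -> common_kernel (j :: s) b.
  by move=> sb jb i; rewrite inE => /orP[/eqP->|/sb].
suff [psi psif] : exists psi : gend A, forall b, common_kernel s b ->
    (f - psi *: phi j : ghom B A) b = 0.
  have [c cE] := IH us _ psif.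
  exists (fun i => if i == j then psi else c i).
  rewrite big_cons eqxx -[LHS](subrK (psi *: phi j)) addrC cE; congr (_ + _).
  apply: eq_big_seq => i si; case: eqP => // ij.
  by rewrite -ij si in js.
have [s0|sT] := common_kernel_image s (phi j).
  exists 0 => b sb; rewrite scale0r subr0; apply: f0; apply: sj => //.
  have : (phi j @` common_kernel s) (phi j b) by exists b.
  by rewrite s0.
have hm a : exists m, common_kernel s m /\ phi j m = a.
  have : (phi j @` common_kernel s) a by rewrite sT.
  by move=> [m sm ma]; exists m.
have [m /all_and2[sm mE]] := choice hm.
have wd x y : common_kernel s x -> common_kernel s y -> phi j x = phi j y -> f x = f y.
  move=> sx sy xy; apply/subr0_eq; rewrite -ghomN -ghomD; apply: f0; apply: sj.
    exact: common_kernelB.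
  by rewrite ghomD ghomN xy subrr.
have sD x y : common_kernel s x -> common_kernel s y -> common_kernel s (x + y).
  by move=> sx sy i si; rewrite ghomD sx ?sy ?addr0.
have psiD : {morph f \o m : x y / x + y}.
  move=> x y /=; rewrite -ghomD; apply: wd => //; first exact: sD.
  by rewrite ghomD !mE.
have psig g x : (f \o m) (act g x) = act g ((f \o m) x).
  rewrite /= -ghom_act; apply: wd => //; last by rewrite ghom_act !mE.
  by move=> i si; rewrite ghom_act sm ?act0.
exists (ghom_of psiD (open_points_continuous oA) psig) => b sb.
rewrite sub_ghomE scale_ghomE (wd b (m (phi j b))) ?mE //.
exact: subrr.
Qed.

End CommonKernel.

Section Basis.
Variables (I : choiceType) (phi : I -> ghom B A).
Hypothesis phiB : is_basis (phi : I -> (ghom B A : lmodType (gend A))).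

(** By independence the common kernel of the other members is not contained in
    the kernel of [phi i], so [phi i] maps it onto [A]. *)
Lemma basis_surjective (s : seq I) (a : I -> A) :
  exists b, forall i, i \in s -> phi i b = a i.
Proof.
elim: s => [|i s [b sb]]; first by exists 0.
have [si|si] := boolP (i \in s).
  by exists b => j; rewrite inE => /orP[/eqP->|]; exact: sb.
suff sT : phi i @` common_kernel phi s = setT.
  have : (phi i @` common_kernel phi s) (a i - phi i b) by rewrite sT.
  move=> [m sm mE]; exists (b + m) => j; rewrite inE ghomD => /orP[/eqP->|sj].
    by rewrite mE addrC subrK.
  by rewrite sm // addr0 sb.
have [s0|//] := common_kernel_image phi s (phi i); exfalso.
have [|c cE] := @common_kernel_span _ phi (undup s) (undup_uniq s) (phi i).
  move=> m sm; have : (phi i @` common_kernel phi s) (phi i m).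
    by exists m => // j js; apply: sm; rewrite mem_undup.
  by rewrite s0.
(* The coefficients of the relation that would express [phi i] through [s]. *)
pose d j : gend A := if j == i then -1 else if j \in s then c j else 0.
have d0 j : j \notin i :: undup s -> d j = 0.
  by rewrite inE mem_undup negb_or /d => /andP[/negPf-> /negPf->].
have [a0 a0N] := Asimple.1.
have : d i = 0.
  apply: phiB.1.
    apply: (@sub_finite_set _ _ [set` i :: undup s]); last exact: finite_seq.
    by move=> j /= dj; apply: contraNT dj => /d0/eqP.
  rewrite (fsbigE (i :: undup s)) //=; last first.
  - by move=> j _ /d0 ->; rewrite scale0r.
  - by rewrite mem_undup si undup_uniq.
  rewrite big_cons mem_set // {1}/d eqxx scaleN1r {1}cE addrC.
  apply/eqP; rewrite subr_eq0; apply/eqP.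
  rewrite big_mkcond; apply: eq_big_seq => j; rewrite mem_undup => js.
  by rewrite mem_set // /d js; case: eqP => // ji; rewrite -ji js in si.
rewrite /d eqxx => /(congr1 (fun f : gend A => (f : ghom A A) a0)) /eqP.
by rewrite [X in X == _](_ : _ = - a0) // oppr_eq0 (negPf a0N).
Qed.
End Basis.
End Span.

(** * Extensions with abelian kernel *)

Lemma extension_section (E G : profiniteGroupType) (eta : epi E G)
    (ab : abelian_ker eta) (A : gmodType G) : simple_gmod A ->
  gmod_iso (kerMod ab) A -> exists v : G -> E, continuous v /\ cancel v eta.
Proof.
move=> Asimple iso.
have [U [oU Ueta]] :=
  minimal_kernel_open_complement (simple_minimal_kernel iso Asimple).
exact: local_section oU Ueta.
Qed.

Lemma fibprod_section (G : topGroupType) (I : Type) (E : I -> topGroupType)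
    (eta : forall i, epi (E i) G) :
  (forall i, exists v : G -> E i, continuous v /\ cancel v (eta i)) ->
  exists v : G -> fibprod eta, continuous v /\ cancel v (fibprod_epi eta).
Proof.
move=> /family_choice[v /all_and2[vc vp]].
exists (fun g => mk_fibprod (fun i => vp i g)); split=> //.
by apply: fibprod_continuous => // g; exact: cvg_id.
Qed.

Section AbelianKernel.
Variables (Q G : profiniteGroupType) (q : epi Q G) (ab : abelian_ker q).
Variable A : gmodType G.
Hypothesis Asimple : finite_simple_gmod A.
Local Notation B := (kerMod ab).

Let oA : forall a : A, open [set a]. Proof. by case: Asimple. Qed.
Let sA : simple_gmod A. Proof. by case: Asimple. Qed.

Section KernelQuotient.
Variable phi : ghom B A.

Definition nsub_ker_ghom : normalSubgroup Q.
Proof.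
apply: (@NormalSubgroup Q ((val : B -> Q) @` [set b | phi b = 0])).
- by exists 0 => //=; exact: ghom0.
- move=> _ _ [b b0 <-] [c c0 <-]; exists (b + c) => //=.
  by rewrite ghomD b0 c0 addr0.
- by move=> _ [b b0 <-]; exists (- b) => //=; rewrite ghomN b0 oppr0.
- move=> _ y [b b0 <-]; exists (kerMod_conj y^-1%g b) => /=.
    by rewrite -kerMod_actE -[LHS]/(phi (act (q y^-1%g) b)) ghom_act b0 act0.
  by rewrite invgK conjgE mulgA.
- apply: closed_image; [exact: kerMod_compact|exact: profinite_hausdorff
    |exact: val_kerMod_continuous|].
  change (closed ((phi : B -> A) @^-1` [set 0])).
  have /continuous_closedP := @ghom_continuous _ _ _ phi; apply.
  exact/accessible_closed_set1/hausdorff_accessible/open_points_hausdorff.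
Defined.

Lemma nsub_ker_ghom_sub : nsub nsub_ker_ghom `<=` ker q.
Proof. by move=> _ [b _ <-]; exact: kerModP. Qed.

(** The extension is [Q / Ker phi], whose kernel [phi] identifies with [A]. *)
Lemma quotient_extension : (forall a, exists b, phi b = a) ->
  exists (E : profiniteGroupType) (eta : epi E G) (ab' : abelian_ker eta)
    (theta : ghom (kerMod ab') A) (f : hom_over q eta),
    gmod_isom theta /\ forall b, theta (ker_hom ab ab' f b) = phi b.
Proof.
move=> phiS; pose N := nsub_ker_ghom; pose NK := nsub_ker_ghom_sub.
pose f := qproj_hom NK.
have ab' : abelian_ker (quot_epi NK).
  move=> x y; rewrite -[x]qprojK -[y]qprojK /ker /= !quot_map_qproj => kx ky.
  by rewrite /commute -!qprojM ab.
pose r := ker_hom ab ab' f.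
have rS (y : kerMod ab') : exists b, r b = y.
  have ky : ker q (repr (val y)) by exact: (kerModP y).
  have [b bE] := kerMod_mem ab ky.
  exists b; apply/val_inj; rewrite ker_homE bE -[RHS]qprojK //.
have r0 b : r b = 0 <-> phi b = 0.
  split=> [/(congr1 val)/qproj_eq1[c c0 /val_inj <-//]|b0].
  by apply/val_inj/qproj_eq1; exists b.
have [t tK] := choice rS.
pose theta y := phi (t y).
have thetar b : theta (r b) = phi b.
  apply/subr0_eq; rewrite -ghomN -ghomD; apply/r0.
  by rewrite ghomD ghomN tK subrr.
have thetaD : {morph theta : x y / x + y}.
  move=> x y; have [b <-] := rS x; have [c <-] := rS y.
  by rewrite -ghomD !thetar ghomD.
have thetag g x : theta (act g x) = act g (theta x).
  by have [b <-] := rS x; rewrite -ghom_act !thetar ghom_act.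
have cB := @kerMod_compact _ _ _ ab.
have thetac : continuous theta.
  apply: (continuous_factor cB (@kerMod_hausdorff _ _ _ ab') _ rS).
    exact: ghom_continuous.
  have -> : theta \o r = phi by apply/funext => b; exact: thetar.
  exact: ghom_continuous.
exists (quotg N), (quot_epi NK), ab', (ghom_of thetaD thetac thetag), f.
split=> //; apply: bij_gmod_isom.
- exact: kerMod_compact.
- exact: open_points_hausdorff.
- by move=> y; have [b <-] := rS y => e; apply/r0; rewrite -thetar.
- by move=> a; have [b <-] := phiS a; exists (r b); exact: thetar.
Qed.

End KernelQuotient.

Section Family.
Variables (I : Type) (phi : I -> ghom B A).
Hypothesis phi_inj : forall b, (forall i, phi i b = 0) -> b = 0.
Hypothesis phi_surj : forall (s : seq {classic I}) (a : I -> A),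
  exists b, forall i : {classic I}, i \in s -> phi i b = a i.

(** On the kernels, read in [A] through the [theta i], the map to the fiber
    product is [b |-> (phi i b)]. *)
Lemma fibprod_of_kernels (E : I -> profiniteGroupType)
    (eta : forall i, epi (E i) G) (ab' : forall i, abelian_ker (eta i))
    (theta : forall i, ghom (kerMod (ab' i)) A) (f : forall i, hom_over q (eta i)) :
  (forall i, injective (theta i)) ->
  (forall i b, theta i (ker_hom ab (ab' i) (f i) b) = phi i b) ->
  iso_over q (fibprod_epi eta).
Proof.
move=> thetaI thetaf.
have cQ := @profinite_compact Q; have hG := @profinite_hausdorff G.
have hE i := @profinite_hausdorff (E i).
apply: (fibprod_iso (f := f)) => //.
  move=> x kx x1; have [b bx] := kerMod_mem ab kx.
  rewrite -bx (phi_inj (b := b)) // => i.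
  rewrite -thetaf (_ : ker_hom _ _ _ _ = 0) ?ghom0 //.
  by apply/val_inj; rewrite ker_homE bx x1.
apply: fibprod_lift_finite => // s y ky.
pose k i : kerMod (ab' i) := Sub (y i) (mem_set (ky i)).
have [b bs] := phi_surj s (fun i => theta i (k i)).
exists (val b); split=> [|i si]; first exact: kerModP.
have e : ker_hom ab (ab' i) (f i) b = k i by apply: thetaI; rewrite thetaf bs.
exact: (congr1 val e).
Qed.

Let phi_onto i a : exists b, phi i b = a.
Proof.
have [b bE] := phi_surj [:: i : {classic I}] (fun=> a).
by exists b; apply: bE; exact: mem_head.
Qed.

(** [Q] is the fiber product of its quotients by the [Ker (phi i)].  These have
    minimal kernels, so each of them has a continuous section. *)
Lemma abelian_kernel_section : exists u : G -> Q, continuous u /\ cancel u q.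
Proof.
have [E /family_choice[eta /family_choice[ab' /family_choice[theta]]]] :=
  family_choice (fun i => quotient_extension (phi_onto i)).
move=> /family_choice[f /all_and2[thetaI thetaf]].
have iso : iso_over q (fibprod_epi eta).
  apply: (fibprod_of_kernels (ab' := ab') (theta := theta) (f := f)) => // i.
  by have [theta' [thetaK _]] := thetaI i; exact: can_inj thetaK.
have [F [F' [FK F'K]]] := iso_over_hom iso.
have [i|v [vc vp]] := @fibprod_section G I _ eta.
  by apply: (extension_section (ab := ab' i) sA); exists (theta i).
exists (F' \o v); split=> [x|g]; last by rewrite /= hom_base vp.
by apply: continuous_comp; [exact: vc|exact: hom_continuous].
Qed.

Lemma abelian_kernel_extensions : exists (E : I -> profiniteGroupType)
    (eta : forall i, epi (E i) G),
  forall i, extension_of_class (eta i) (H2map (phi i) (ext_class ab)).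
Proof.
have h i : exists (E : profiniteGroupType) (eta : epi E G),
    extension_of_class eta (H2map (phi i) (ext_class ab)).
  have [E [eta [ab' [theta [f [thetaI thetaf]]]]]] := quotient_extension (phi_onto i).
  exists E, eta, ab', theta; split=> //.
  rewrite -(H2map_ker_hom ab ab' abelian_kernel_section f) -H2map_comp.
  by congr H2map; apply: ghomE.
by have [E /family_choice[eta etaP]] := family_choice h; exists E, eta.
Qed.

(** Once [Ker (eta i)] is identified with [A], the equality of classes extends
    [phi i] to a homomorphism from [Q] to [E i] over [G]. *)
Lemma abelian_kernel_fibprod (E : I -> profiniteGroupType)
    (eta : forall i, epi (E i) G) :
  (forall i, extension_of_class (eta i) (H2map (phi i) (ext_class ab))) ->
  iso_over q (fibprod_epi eta).
Proof.
move=> /family_choice[ab' /family_choice[theta /all_and2[thetaI thetaC]]].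
have hf i : exists f : hom_over q (eta i),
    forall b, theta i (ker_hom ab (ab' i) f b) = phi i b.
  have [theta' [thetaK Ktheta]] := thetaI i.
  have [|||f fE] := @hom_of_class _ _ _ q (eta i) ab (ab' i) _ _ (comp_ghom theta' (phi i)).
  - exact: abelian_kernel_section.
  - by apply: (extension_section (ab := ab' i) sA); exists (theta i).
  - rewrite H2map_comp -thetaC -H2map_comp; apply: H2map_id => x; exact: thetaK.
  exists f => b; rewrite -[RHS]Ktheta; congr (theta i _).
  by apply/val_inj; rewrite ker_homE fE.
have [f thetaf] := family_choice hf.
apply: (fibprod_of_kernels (ab' := ab') (theta := theta) (f := f)) => // i.
by have [theta' [thetaK _]] := thetaI i; exact: can_inj thetaK.
Qed.

End Family.

End AbelianKernel.

Local Close Scope ring_scope.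

(** * The components of a fundamental epimorphism *)

Lemma abelian_ker_iso (G H E : topGroupType) (q : epi H G) (eta : epi E G) :
  iso_over q eta -> abelian_ker q -> abelian_ker eta.
Proof.
move=> /iso_over_hom[f [g [fK gK]]] ab x y ex ey.
rewrite -[x]gK -[y]gK; apply: gmulf_commute.
by apply: ab; rewrite /ker /= hom_base.
Qed.

Section Types.
Variables (H G : profiniteGroupType) (p : epi H G).
Implicit Types (N : normalSubgroup H).

Section NonAbelian.
Variables (E : profiniteGroupType) (zeta : epi E G).

Lemma C_na_maximal N : minimal_kernel zeta -> C_na p zeta N ->
  maximal_normal (ker p) N.
Proof.
move=> zmin [NK iso]; apply/(maximal_minimal_kernel NK).
by apply: minimal_kernel_iso zmin; exact: iso_over_sym.
Qed.

Lemma C_na_not_abelian N : ~ abelian_ker zeta -> C_na p zeta N -> ~ abelian_mod p N.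
Proof. by move=> zna [NK iso] /(abelian_modP NK) /(abelian_ker_iso iso). Qed.

End NonAbelian.

Section Abelian.
Variable A : gmodType G.

Lemma C_ab_maximal N : simple_gmod A -> C_ab p A N -> maximal_normal (ker p) N.
Proof.
move=> Asimple [NK [ab iso]]; apply/(maximal_minimal_kernel NK).
exact: simple_minimal_kernel iso Asimple.
Qed.

Lemma C_ab_abelian N : C_ab p A N -> abelian_mod p N.
Proof. by move=> [NK [ab _]]; exact/(abelian_modP NK). Qed.

End Abelian.

(** The isomorphism sends the class modulo [N] of an element of the common
    complement to its class modulo [N']. *)
Lemma linked_kerMod_iso N N' (NK : nsub N `<=` ker p) (NK' : nsub N' `<=` ker p)
    (ab : abelian_ker (quot_epi NK)) (ab' : abelian_ker (quot_epi NK')) :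
  maximal_normal (ker p) N -> maximal_normal (ker p) N' -> linked p N N' ->
  gmod_iso (kerMod ab) (kerMod ab').
Proof.
move=> Nmax N'max [/normalSubgroup_eq NN'|[_ _ [M [MK MN MN' MNN']]]].
  subst N'; rewrite (Prop_irrelevance NK' NK) in ab' *.
  rewrite (Prop_irrelevance ab' ab); exact: gmod_iso_refl.
have wd a b : nsub M a -> nsub M b -> qproj N a = qproj N b <-> qproj N' a = qproj N' b.
  by move=> Ma Mb; split=> /qprojP/MNN' h; apply/qprojP/h; apply: nsubM => //; exact: nsubV.
have hm (y : kerMod ab) : exists m, nsub M m /\ qproj N m = val y.
  have [|m [n [Mm Nn e]]] := maximal_mul_cover Nmax MK MN (x := repr (val y)).
    exact: (kerModP y).
  exists m; split=> //; rewrite -[val y]qprojK e qprojM.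
  by rewrite ((qproj_eq1 _ _).2 Nn) mulg1.
have [m /all_and2[Mm mE]] := choice hm.
have mk y : qproj N' (m y) \in ker (quot_epi NK').
  by apply/mem_set; rewrite /ker /= quot_map_qproj; exact: MK.
pose f y : kerMod ab' := Sub (qproj N' (m y)) (mk y).
have fD : {morph f : x y / (x + y)%R}.
  move=> x y; apply/val_inj => /=; rewrite -qprojM; apply/wd => //.
    exact: nsubM.
  by rewrite qprojM !mE.
have fg g x : f (act g x) = act g (f x).
  have [h <-] := epi_surj p g.
  have e1 : act (p h) x = kerMod_conj (qproj N h) x.
    by rewrite -(quot_map_qproj NK); exact: kerMod_actE.
  have e2 (y : kerMod ab') : act (p h) y = kerMod_conj (qproj N' h) y.
    by rewrite -(quot_map_qproj NK'); exact: kerMod_actE.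
  rewrite e2; apply/val_inj.
  change (qproj N' (m (act (p h) x)) = qproj N' h * qproj N' (m x) * (qproj N' h)^-1).
  rewrite -qprojV -!qprojM; apply/wd => //.
    by have := nsubJ h^-1 (Mm x); rewrite conjgE invgK mulgA.
  rewrite mE e1; change (qproj N h * val x * (qproj N h)^-1 = qproj N (h * m x * h^-1)).
  by rewrite -mE -qprojV -!qprojM.
have [U [oU Up]] := minimal_kernel_open_complement ((maximal_minimal_kernel NK).1 Nmax).
have cf : continuous f := open_points_continuous (kerMod_open_points oU Up).
exists (ghom_of fD cf fg); apply: bij_gmod_isom.
- exact: kerMod_compact.
- exact: kerMod_hausdorff.
- move=> x /(congr1 val) /= e; apply/val_inj; rewrite -mE.
  apply/(wd _ 1 (Mm x) (nsub1 M)); exact: e.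
- move=> y; have [|a [n [Ma Nn e]]] := maximal_mul_cover N'max MK MN' (x := repr (val y)).
    exact: (kerModP y).
  have ka : ker (quot_epi NK) (qproj N a).
    by rewrite /ker /= quot_map_qproj; exact: MK.
  have [x xE] := kerMod_mem ab ka.
  exists x; apply/val_inj => /=.
  rewrite -[val y]qprojK e qprojM ((qproj_eq1 _ _).2 Nn) mulg1; apply/wd => //.
  by rewrite mE xE.
Qed.

End Types.

Section Components.
Variables (G H : profiniteGroupType) (p : epi H G).
Variables (Lna : Type) (Ena : Lna -> profiniteGroupType).
Variable zeta : forall z, epi (Ena z) G.
Variables (Lab : Type) (A : Lab -> gmodType G).
Hypotheses (hna : Lambda_na zeta) (hab : Lambda_ab A).

Definition component (k : Lna + Lab) : set (normalSubgroup H) :=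
  match k with inl z => C_na p (zeta z) | inr l => C_ab p (A l) end.

Lemma zeta_minimal_kernel z : minimal_kernel (zeta z).
Proof. by apply: indecomposable_minimal_kernel; exact: (hna.1 z).1. Qed.

Lemma component_maximal k : component k `<=` maximal_normal (ker p).
Proof.
case: k => [z|l] N /=; first by apply: C_na_maximal; exact: zeta_minimal_kernel.
by apply: C_ab_maximal; have [_ _ _] := hab.1 l.
Qed.

Lemma maximal_component N : maximal_normal (ker p) N -> exists k, component k N.
Proof.
move=> Nmax; have NK := maximal_sub Nmax.
have Nmin := (maximal_minimal_kernel NK).1 Nmax.
have [ab|nab] := pselect (abelian_ker (quot_epi NK)).
  have [l [iso _]] := hab.2 _ (minimal_kernel_simple ab Nmin).
  by exists (inr l), NK, ab.
have [z [iso _]] := hna.2 _ _ (minimal_kernel_indecomposable Nmin) nab.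
by exists (inl z), NK.
Qed.

(** The quotient of [Ker p] by a maximal subgroup determines its component, and
    linked subgroups are equal or have isomorphic module quotients. *)
Lemma component_linked k k' N N' : component k N -> component k' N' ->
  linked p N N' -> k = k'.
Proof.
move=> kN kN' NN'; have Nmax := component_maximal kN; have N'max := component_maximal kN'.
case: k k' kN kN' => [z|l] [z'|l'] /= kN kN'.
- have zna := C_na_not_abelian (hna.1 z).2 kN.
  case: NN' => [/normalSubgroup_eq NN'|[]//]; subst N'.
  case: kN kN' => NK iso [NK' iso'].
  rewrite (Prop_irrelevance NK' NK) in iso'.
  have nab : ~ abelian_ker (quot_epi NK) by move/(abelian_modP NK).
  have Nmin := (maximal_minimal_kernel NK).1 Nmax.
  have [z0 [_ uz]] := hna.2 _ _ (minimal_kernel_indecomposable Nmin) nab.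
  by rewrite -(uz _ iso) -(uz _ iso').
- have zna := C_na_not_abelian (hna.1 z).2 kN.
  by case: NN' => [/normalSubgroup_eq NN'|[]//]; subst N'; have := C_ab_abelian kN'.
- have zna := C_na_not_abelian (hna.1 z').2 kN'.
  by case: NN' => [/normalSubgroup_eq NN'|[]//]; subst N'; have := C_ab_abelian kN.
- case: kN kN' => NK [ab iso] [NK' [ab' iso']].
  have iso'' := linked_kerMod_iso ab ab' Nmax N'max NN'.
  have [l0 [_ ul]] := hab.2 _ (hab.1 l).
  rewrite -(ul _ (gmod_iso_refl _)); congr inr; apply: ul.
  apply: gmod_iso_trans iso'; apply: gmod_iso_trans iso''; exact: gmod_iso_sym.
Qed.

Local Notation pi_ := (sum_epi (fun z => pi_na p (zeta z)) (fun l => pi_ab p (A l))).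

Definition component_hom k : hom_over p (pi_ k) :=
  match k return hom_over p (pi_ k) with
  | inl z => qproj_hom (@ker_bigcap_sub _ _ p (C_na p (zeta z)))
  | inr l => qproj_hom (@ker_bigcap_sub _ _ p (C_ab p (A l)))
  end.

Lemma component_homP k x y : component_hom k x = component_hom k y <->
  nsub (ker_bigcap p (component k)) (x^-1 * y).
Proof. by case: k => [z|l]; exact: qprojP. Qed.

Lemma component_hom_surj k y : exists x, component_hom k x = y.
Proof. by case: k y => [z|l] y; exists (repr y); exact: qprojK. Qed.

Lemma component_hausdorff k : hausdorff_space
  (sum_group (fun z => H_na p (zeta z)) (fun l => H_ab p (A l)) k).
Proof. by case: k => [z|l]; exact: quotg_hausdorff. Qed.

(** Members of different components are not linked, so finitely many components
    can be prescribed independently. *)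
Lemma components_lift g (y : forall k, sum_group (fun z => H_na p (zeta z))
    (fun l => H_ab p (A l)) k) : (forall k, pi_ k (y k) = g) ->
  exists x, p x = g /\ forall k, component_hom k x = y k.
Proof.
apply: fibprod_lift_finite; [exact: profinite_compact|exact: profinite_hausdorff
  |exact: component_hausdorff|].
move=> {}s {}y ky.
have [x xE] := family_choice (fun k => component_hom_surj (y k)).
have kx k : ker p (x k) by rewrite /ker /= -(hom_base (component_hom k)) xE; exact: ky.
have [|z [kz zx]] := @finite_approximation H G p {classic (Lna + Lab)%type}
  (fun k => ker_bigcap p (component k)) _ s x kx; last first.
  by exists z; split=> // i si; rewrite -xE; apply/component_homP; exact: zx.
move=> i t it {kx xE}x kx.
have [|||z [kz zC zD]] := @unlinked_mul_cover H G p
    (\bigcup_(k in [set k : Lna + Lab |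
       (k : {classic (Lna + Lab)%type}) \in t]) component k)
    (component i) _ _ _ x kx.
- by move=> N [k _]; exact: component_maximal.
- exact: component_maximal.
- by move=> N N' [k kt kN] iN' /(component_linked kN iN') ki; rewrite -ki kt in it.
- exists z; split=> // [j jt|].
    by split=> // N jN; apply: zC; exists j.
  split; first by rewrite /ker /= gmulfM gmulfV kz kx invg1 mulg1.
  exact: zD.
Qed.

Hypothesis hp : fundamental p.

Lemma components_inj x : ker p x -> (forall k, component_hom k x = 1) -> x = 1.
Proof.
move=> kx k1; have : fundament_kernel p x; last by rewrite hp.
split=> // N /maximal_component[k kN].
have /component_homP : component_hom k 1 = component_hom k x by rewrite k1 gmulf1.
by rewrite invg1 mul1g => -[_]; apply.
Qed.

Lemma components_iso : iso_over p (fibprod_epi pi_).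
Proof.
apply: fibprod_iso; [exact: profinite_compact|exact: profinite_hausdorff
  |exact: component_hausdorff|exact: components_inj|exact: components_lift].
Qed.

Lemma components_iso2 : iso_over p (fibprod2_epi
  (fibprod_epi (fun z => pi_na p (zeta z))) (fibprod_epi (fun l => pi_ab p (A l)))).
Proof.
pose f (b : unit + unit) : hom_over p (sum_epi
    (fun=> fibprod_epi (fun z => pi_na p (zeta z)))
    (fun=> fibprod_epi (fun l => pi_ab p (A l))) b) :=
  match b with
  | inl _ => fibprod_pair (fun z => component_hom (inl z))
  | inr _ => fibprod_pair (fun l => component_hom (inr l))
  end.
have hQ := @quotg_hausdorff H; have hG := @profinite_hausdorff G.
apply: (@fibprod_iso H G p _ _ _ f (@profinite_compact H) hG).
- by case=> u /=; apply: fibprod_hausdorff => // i; exact: hQ.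
- move=> x kx x1; apply: components_inj => // -[z|l].
    exact: (congr1 (fun y => fibprod_coord y z) (x1 (inl tt))).
  exact: (congr1 (fun y => fibprod_coord y l) (x1 (inr tt))).
- move=> g y yg; pose y1 : fibprod _ := y (inl tt); pose y2 : fibprod _ := y (inr tt).
  have y1g : fibprod_base y1 = g by exact: (yg (inl tt)).
  have y2g : fibprod_base y2 = g by exact: (yg (inr tt)).
  have [|x [xg xy]] := @components_lift g (fun k => match k with
    | inl z => fibprod_coord y1 z | inr l => fibprod_coord y2 l end).
    case=> [z|l]; first exact: (etrans (fibprodP y1 z) y1g).
    exact: (etrans (fibprodP y2 l) y2g).
  exists x; split=> // -[[]|[]]; apply: fibprod_eq => [|i].
  + by rewrite -[RHS]/(fibprod_base y1) y1g.
  + exact: (xy (inl i)).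
  + by rewrite -[RHS]/(fibprod_base y2) y2g.
  + exact: (xy (inr i)).
Qed.

End Components.

Lemma card_eq_enumeration (I T : Type) (C : set T) : ([set: I] #= C)%card ->
  exists nu : I -> T, [/\ forall i, C (nu i), injective nu
    & forall x, C x -> exists i, nu i = x].
Proof.
move=> /card_bijP[f [g fK gK]].
pose mk i : [set: I] := Sub i (mem_set (Logic.I : [set: I] i)).
exists (fun i => val (f (mk i))); split=> [i|i j /val_inj/(can_inj fK)|x Cx].
- exact: set_valP.
- by move/(congr1 val).
- pose y : C := Sub x (mem_set Cx).
  by exists (val (g y)); rewrite (_ : mk _ = g y) ?gK //; apply/val_inj.
Qed.

(** A member whose quotient is not abelian is linked to no other member, so the
    members of a non-abelian component can be prescribed independently. *)
Lemma na_component_iso (G H : profiniteGroupType) (p : epi H G)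
    (E : profiniteGroupType) (zeta : epi E G) (I : Type)
    (F : I -> profiniteGroupType) (eta : forall i, epi (F i) G) :
  minimal_kernel zeta -> ~ abelian_ker zeta ->
  ([set: I] #= C_na p zeta)%card -> (forall i, iso_over (eta i) zeta) ->
  iso_over (pi_na p zeta) (fibprod_epi eta).
Proof.
move=> zmin zna /card_eq_enumeration[nu [nuC nuI nuS]] iso.
have numax i : maximal_normal (ker p) (nu i) by exact: C_na_maximal (nuC i).
have hP i : exists h : hom_over p (eta i), (forall x, h x = 1 <-> nsub (nu i) x) /\
    forall y, exists x, h x = y.
  have [NK iso'] := nuC i.
  have [f [g [fK gK]]] := iso_over_hom (iso_over_trans iso' (iso_over_sym (iso i))).
  exists (comp_hom f (qproj_hom NK)); split=> [x|y].
    split=> [/= fx|Nx]; last by rewrite /= ((qproj_eq1 _ _).2 Nx) gmulf1.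
    by apply/qproj_eq1; rewrite -[LHS]fK fx gmulf1.
  by exists (repr (g y)); rewrite /= qprojK gK.
have [h /all_and2[hker hS]] := family_choice hP.
have hN i x : nsub (ker_bigcap p (C_na p zeta)) x -> h i x = 1.
  by move=> [_ /(_ _ (nuC i))]; move=> Nx; apply/hker.
pose f i := factor_hom (@ker_bigcap_sub _ _ p (C_na p zeta)) (hN i).
have fE i x : f i (qproj _ x) = h i x by exact: factor_homE.
have hG := @profinite_hausdorff G; have hF i := @profinite_hausdorff (F i).
have cQ := @quotg_compact H (ker_bigcap p (C_na p zeta)).
apply: (fibprod_iso (f := f)) => //.
  move=> x; rewrite -[x]qprojK /ker /= quot_map_qproj => kx x1.
  apply/qproj_eq1; split=> // N /nuS[i <-].
  by apply/hker; rewrite -fE; exact: x1.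
apply: fibprod_lift_finite => // s y ky.
have [x xE] := family_choice (fun i => hS i (y i)).
have kx i : ker p (x i) by rewrite /ker /= -(hom_base (h i)) xE; exact: ky.
have [|z [kz zx]] := @finite_approximation H G p {classic I} nu _ s x kx; last first.
  exists (qproj _ z); split=> [|i si]; first by rewrite /ker /= quot_map_qproj.
  rewrite fE -xE; have /hker := zx i si; rewrite gmulfM gmulfV => e.
  by rewrite -[RHS](mulVKg (h i z)) e mulg1.
move=> i t it {kx xE}x kx.
have [|||z [kz zC zD]] := @unlinked_mul_cover H G p
    [set N | exists2 j : {classic I}, j \in t & N = nu j] [set nu i] _ _ _ x kx.
- by move=> _ [j _ ->].
- by move=> _ ->.
- move=> _ _ [j jt ->] -> [/normalSubgroup_eq/nuI ji|[_ ab _]].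
    by rewrite -ji jt in it.
  exact: C_na_not_abelian (nuC i) ab.
- exists z; split=> // [j jt|]; last exact: zD.
  by apply: zC; exists j.
Qed.

Section AbelianComponent.

Local Open Scope ring_scope.

Variables (G H : profiniteGroupType) (p : epi H G) (A : gmodType G).
Hypothesis Asimple : finite_simple_gmod A.
Variables (J : choiceType) (phi : J -> B_dual p A).
Hypothesis phiB : is_basis phi.

(** Each member of [C_ab p A] is the kernel of an element of the dual, which is a
    combination of the basis. *)
Lemma ab_component_inj (b : B_ab p A) : (forall j, (phi j : ghom _ _) b = 0) -> b = 0.
Proof.
move=> b0; have [x xE] : exists x, qproj _ x = val b.
  by exists (repr (val b)); exact: qprojK.
apply/val_inj; rewrite -xE; apply/qproj_eq1; split=> [|N NC].
  by have := kerModP b; rewrite -xE /= quot_map_qproj.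
have [NK [ab [theta [theta' [thetaK _]]]]] := NC.
have hN y : nsub (ker_bigcap p (C_ab p A)) y -> qproj_hom NK y = 1%g.
  by move=> [_ /(_ _ NC) Ny]; exact/qproj_eq1.
pose g := factor_hom (@ker_bigcap_sub _ _ p (C_ab p A)) hN.
pose f : B_dual p A := comp_ghom theta (ker_hom (@pi_ab_abelian _ _ p A) ab g).
have fb0 : (f : ghom _ _) b = 0.
  have [c cfin ->] := phiB.2 f.
  have /finite_seqP[s cs] := cfin.
  rewrite (fsbigE (undup s)) ?undup_uniq //=; last first.
    move=> i _; rewrite mem_undup => si; have [->|ci] := eqVneq (c i) 0.
      exact: scale0r.
    have : [set` s] i by rewrite -cs.
    by rewrite /= (negPf si).
  rewrite [LHS](sum_ghomE (B := B_ab p A)) big1 // => i _.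
  by rewrite scale_ghomE b0 ghom0.
apply/qproj_eq1; rewrite -[LHS](factor_homE (@ker_bigcap_sub _ _ p (C_ab p A)) hN).
have /(congr1 val) : ker_hom (@pi_ab_abelian _ _ p A) ab g b = 0.
  by apply: (can_inj thetaK); rewrite ghom0.
by rewrite ker_homE -xE.
Qed.

Lemma ab_component_surj (s : seq {classic J}) (a : J -> A) :
  exists b : B_ab p A, forall j : {classic J}, j \in s -> (phi j : ghom _ _) b = a j.
Proof.
have [_ oA _ sA] := Asimple.
have [b bE] := basis_surjective oA sA phiB s a; exists b => j js; apply: bE.
(* Membership in [s] is tested with two decision procedures for equality. *)
elim: s js => //= i s IH; rewrite !inE => /orP[/eqP->|/IH->]; rewrite ?eqxx ?orbT //.
Qed.

Lemma ab_component_extensions :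
  exists (E : J -> profiniteGroupType) (eta : forall i, epi (E i) G),
  forall i, extension_of_class (eta i) (S_ab (phi i)).
Proof.
exact: (abelian_kernel_extensions (Q := quotg _) Asimple
  ab_component_inj ab_component_surj).
Qed.

Lemma ab_component_iso (E : J -> profiniteGroupType) (eta : forall i, epi (E i) G) :
  (forall i, extension_of_class (eta i) (S_ab (phi i))) ->
  iso_over (pi_ab p A) (fibprod_epi eta).
Proof.
exact: (abelian_kernel_fibprod (Q := quotg _) Asimple
  ab_component_inj ab_component_surj).
Qed.

End AbelianComponent.

(** * The decomposition *)

Lemma iso_over_hom_bij (G H E : topGroupType) (q : epi H G) (eta : epi E G) :
  iso_over q eta -> exists f : hom_over q eta,
    (forall x, f x = 1 -> x = 1) /\ forall y, exists x, f x = y.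
Proof.
move=> /iso_over_hom[f [g [fK gK]]]; exists f; split=> [x fx|y].
  by rewrite -[x]fK fx gmulf1.
by exists (g y).
Qed.

(** A fiber product of fiber products over [G] is the fiber product over the
    disjoint union of the index types. *)
Lemma refined_iso (G H : profiniteGroupType) (p : epi H G)
    (Lna : Type) (Ena : Lna -> profiniteGroupType) (zeta : forall z, epi (Ena z) G)
    (Lab : Type) (A : Lab -> gmodType G)
    (hp : fundamental p) (hna : Lambda_na zeta) (hab : Lambda_ab A)
    (I : Lna -> Type) (E : forall z, I z -> profiniteGroupType)
    (eta : forall z i, epi (E z i) G)
    (J : Lab -> Type) (F : forall l, J l -> profiniteGroupType)
    (theta : forall l j, epi (F l j) G) :
  (forall z, iso_over (pi_na p (zeta z)) (fibprod_epi (eta z))) ->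
  (forall l, iso_over (pi_ab p (A l)) (fibprod_epi (theta l))) ->
  iso_over p (fibprod_epi (sum_epi
    (fun k : {z : Lna & I z} => eta (projT1 k) (projT2 k))
    (fun k : {l : Lab & J l} => theta (projT1 k) (projT2 k)))).
Proof.
move=> ena eab.
have [a /all_and2[a_inj a_surj]] := family_choice (fun z => iso_over_hom_bij (ena z)).
have [b /all_and2[b_inj b_surj]] := family_choice (fun l => iso_over_hom_bij (eab l)).
pose f k : hom_over p (sum_epi
    (fun k : {z : Lna & I z} => eta (projT1 k) (projT2 k))
    (fun k : {l : Lab & J l} => theta (projT1 k) (projT2 k)) k) :=
  match k with
  | inl k => comp_hom (fibprod_proj (eta (projT1 k)) (projT2 k))
      (comp_hom (a (projT1 k)) (component_hom p zeta A (inl (projT1 k))))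
  | inr k => comp_hom (fibprod_proj (theta (projT1 k)) (projT2 k))
      (comp_hom (b (projT1 k)) (component_hom p zeta A (inr (projT1 k))))
  end.
apply: (@fibprod_iso H G p _ _ _ f (@profinite_compact H) (@profinite_hausdorff G)).
- by case=> k; exact: profinite_hausdorff.
- move=> x kx x1; apply: (components_inj hna hab hp kx) => -[z|l].
    apply: a_inj; apply: fibprod_eq => [|i].
      exact: (etrans (hom_base (a z) _) (etrans (quot_map_qproj _ x) kx)).
    exact: (x1 (inl (existT _ z i))).
  apply: b_inj; apply: fibprod_eq => [|j].
    exact: (etrans (hom_base (b l) _) (etrans (quot_map_qproj _ x) kx)).
  exact: (x1 (inr (existT _ l j))).
- move=> g y yg.
  pose u z : fibprod (eta z) := mk_fibprod (fun i => yg (inl (existT _ z i))).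
  pose v l : fibprod (theta l) := mk_fibprod (fun j => yg (inr (existT _ l j))).
  have [s sE] := family_choice (fun z => a_surj z (u z)).
  have [t tE] := family_choice (fun l => b_surj l (v l)).
  have [|x [xg xk]] := components_lift hna hab (g := g)
    (y := fun k => match k with inl z => s z | inr l => t l end).
    case=> [z|l]; first exact: (etrans (esym (hom_base (a z) _)) (congr1 _ (sE z))).
    exact: (etrans (esym (hom_base (b l) _)) (congr1 _ (tE l))).
  exists x; split=> // -[[z i]|[l j]] /=.
    exact: (congr1 (fun w : fibprod (eta z) => fibprod_coord w i)
      (etrans (congr1 (a z) (xk (inl z))) (sE z))).
  exact: (congr1 (fun w : fibprod (theta l) => fibprod_coord w j)
    (etrans (congr1 (b l) (xk (inr l))) (tE l))).
Qed.

Theorem proposition8p5 (G H : profiniteGroupType) (p : epi H G)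
    (Lna : Type) (Ena : Lna -> profiniteGroupType) (zeta : forall z, epi (Ena z) G)
    (Lab : Type) (A : Lab -> gmodType G)
    (hp : fundamental p) (hna : Lambda_na zeta) (hab : Lambda_ab A) :
  [/\ iso_over p (fibprod_epi
        (sum_epi (fun z => pi_na p (zeta z)) (fun l => pi_ab p (A l)))),
      iso_over p (fibprod2_epi
        (fibprod_epi (fun z => pi_na p (zeta z)))
        (fibprod_epi (fun l => pi_ab p (A l)))),
      (forall z : Lna,
        exists (I : Type) (E : I -> profiniteGroupType) (eta : forall i, epi (E i) G),
          [/\ ([set: I] #= C_na p (zeta z))%card,
              forall i, iso_over (eta i) (zeta z)
            & iso_over (pi_na p (zeta z)) (fibprod_epi eta)]),
      (forall (l : Lab) (I : choiceType) (phi : I -> B_dual p (A l)),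
        is_basis phi ->
        (exists (E : I -> profiniteGroupType) (eta : forall i, epi (E i) G),
           forall i, extension_of_class (eta i) (S_ab (phi i))) /\
        (forall (E : I -> profiniteGroupType) (eta : forall i, epi (E i) G),
           (forall i, extension_of_class (eta i) (S_ab (phi i))) ->
           iso_over (pi_ab p (A l)) (fibprod_epi eta)))
    & forall (I : Lna -> Type) (E : forall z, I z -> profiniteGroupType)
             (eta : forall z i, epi (E z i) G)
             (J : Lab -> choiceType) (phi : forall l, J l -> B_dual p (A l))
             (F : forall l, J l -> profiniteGroupType)
             (theta : forall l j, epi (F l j) G),
        (forall z, ([set: I z] #= C_na p (zeta z))%card) ->
        (forall z i, iso_over (eta z i) (zeta z)) ->
        (forall l, is_basis (phi l)) ->
        (forall l j, extension_of_class (theta l j) (S_ab (phi l j))) ->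
        [/\ forall z i, indecomposable (eta z i),
            forall l j, indecomposable (theta l j)
          & iso_over p (fibprod_epi (sum_epi
              (fun k : {z : Lna & I z} => eta (projT1 k) (projT2 k))
              (fun k : {l : Lab & J l} => theta (projT1 k) (projT2 k))))]].
Proof.
have zmin := zeta_minimal_kernel hna.
have iso_na z (I : Type) (E : I -> profiniteGroupType) (eta : forall i, epi (E i) G) :
    ([set: I] #= C_na p (zeta z))%card -> (forall i, iso_over (eta i) (zeta z)) ->
    iso_over (pi_na p (zeta z)) (fibprod_epi eta).
  exact: (na_component_iso (zmin z) (hna.1 z).2).
split.
- exact: components_iso.
- exact: components_iso2.
- move=> z; exists (C_na p (zeta z)), (fun=> Ena z), (fun=> zeta z).
  have iso_zeta (i : C_na p (zeta z)) : iso_over (zeta z) (zeta z).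
    exact: iso_over_refl.
  by split=> //; apply: iso_na.
- move=> l I phi phiB; split; first exact: (ab_component_extensions (hab.1 l) phiB).
  by move=> E eta; exact: (@ab_component_iso _ _ _ _ (hab.1 l) _ _ phiB).
- move=> I E eta J phi F theta cardI isoI phiB thetaC; split.
  + move=> z i; apply: minimal_kernel_indecomposable.
    exact: minimal_kernel_iso (iso_over_sym (isoI z i)) (zmin z).
  + move=> l j; apply: minimal_kernel_indecomposable.
    have [ab [f [fI _]]] := thetaC l j; have [_ _ _ Asimple] := hab.1 l.
    by apply: (simple_minimal_kernel (ab := ab) _ Asimple); exists f.
  + apply: (refined_iso hp hna hab) => [z|l]; first exact: iso_na.
    exact: (ab_component_iso (hab.1 l) (phiB l) (thetaC l)).
Qed.
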